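(* In the radio network model with collision detection and with unknown topology, there is a randomized distributed algorithm that broadcasts a single message from the source to all nodes in $O(D + \log^6 n)$ rounds, with high probability.
   Context: Radio network model with collision detection: the network is a connected undirected graph $G=(V,E)$ with $n$ nodes, operating in synchronous rounds. In each round each node either transmits a packet of $B=\Omega(\log n)$ bits or listens. A listening node $v$ receives a packet only if exactly one of its neighbors transmits in that round; if two or more neighbors transmit, $v$ receives a special collision symbol $\top$ (collision detection); if no neighbor transmits, $v$ receives nothing. Single-message broadcast: a designated source node $s$ holds one message of at most $\Theta(B)$ bits, which must be delivered to all nodes. $D$ denotes the diameter of $G$. Unknown topology: nodes do not know the graph, but know a polynomial upper bound on $n$ and a constant-factor upper bound on $D$. ''With high probability'' means with probability at least $1-1/n^{c}$ for a constant $c\ge 1$. *)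

(* Defs.v *)
From mathcomp Require Import all_boot all_order all_algebra.

Set Implicit Arguments.
Unset Strict Implicit.
Unset Printing Implicit Defensive.

Definition connected_graph (V : finType) (e : rel V) : Prop :=
  [/\ symmetric e, irreflexive e & forall u v, connect e u v].

Definition walk (V : finType) (e : rel V) (u v : V) (k : nat) : bool :=
  [exists p : k.-tuple V, path e u p && (last u p == v)].

(* The search range suffices because a shortest walk has fewer than #|V|
   edges (see distP); for disconnected u, v the value is the dummy #|V|. *)
Definition dist (V : finType) (e : rel V) (u v : V) : nat :=
  find (walk e u v) (iota 0 #|V|).

Definition diameter (V : finType) (e : rel V) : nat :=
  \max_(u : V) \max_(v : V) dist e u v.

Lemma distP (V : finType) (e : rel V) (u v : V) : connect e u v ->
  walk e u v (dist e u v) /\ forall k, walk e u v k -> dist e u v <= k.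
Proof.
move=> /connectP[p0 pp0 ->]; case/shortenP: pp0 => p pp up _.
have hw : walk e u (last u p) (size p).
  by apply/existsP; exists (in_tuple p); rewrite pp eqxx.
have hlt : size p < #|V|.
  by have := max_card (mem (u :: p)); rewrite (card_uniqP up).
have hh : has (walk e u (last u p)) (iota 0 #|V|).
  by apply/hasP; exists (size p) => //; rewrite mem_iota.
split=> [|k hk].
  have := nth_find 0 hh; rewrite nth_iota //.
  by rewrite -[X in _ < X](size_iota 0) -has_find.
rewrite leqNgt; apply/negP => lt.
have lt' : k < #|V|.
  by apply: leq_trans lt _; rewrite -[X in _ <= X](size_iota 0) find_size.
by have := before_find 0 lt; rewrite nth_iota // add0n hk.
Qed.

Definition packet (B : nat) := B.-tuple bool.
Definition message := seq bool.

Variant feedback (B : nat) := Nothing | Received of packet B | Collision.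
Arguments Nothing {B}.
Arguments Collision {B}.

(* [acts u = Some x] : u transmits x;  [acts u = None] : u listens.
   A transmitting node learns nothing from the channel. *)
Definition hear (B : nat) (V : finType) (e : rel V)
    (acts : V -> option (packet B)) (v : V) : feedback B :=
  if acts v is Some _ then Nothing else
  match pmap acts [seq u <- enum V | e v u] with
  | [::] => Nothing
  | [:: x] => Received x
  | _ => Collision
  end.

(* The program run by every node, for packets of B bits. Nodes are anonymous:
   the initial state depends only on the input, which is [Some m] at the source
   and [None] elsewhere. In each round a node draws [ncoins] fresh fair coins,
   from which (and its state) it chooses its action, and then updates its
   state using the same coins and the feedback of the channel. *)
Record protocol (B : nat) := Protocol {
  state : Type;
  ncoins : nat;
  init : option message -> state;
  act : state -> ncoins.-tuple bool -> option (packet B);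
  update : state -> ncoins.-tuple bool -> feedback B -> state;
  output : state -> option message
}.

(* Unknown topology: the program may depend only on the upper bound N on the
   number of nodes, the upper bound Dub on the diameter, and the packet size
   B, in this order. *)
Definition algorithm := forall N Dub B : nat, protocol B.

Section Execution.
Variables (B : nat) (P : protocol B) (V : finType) (e : rel V).

Definition config := V -> state P.

Definition coins := {ffun V -> (ncoins P).-tuple bool}.

Definition initial (s : V) (m : message) : config :=
  fun v => init P (if v == s then Some m else None).

Definition round (st : config) (w : coins) : config :=
  let acts v := act (st v) (w v) in
  fun v => update (st v) (w v) (hear e acts v).

Definition run (s : V) (m : message) (t : nat) (w : t.-tuple coins) : config :=
  foldl round (initial s m) w.

Definition delivered (m : message) (st : config) : bool :=
  [forall v, output (st v) == Some m].

End Execution.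

Definition uniform_prob (T : finType) (E : pred T) : rat :=
  (#|[set x | E x]|%:R / #|T|%:R)%R.

(* All coins of all nodes in the first t rounds are independent and fair. *)
Definition delivery_prob (B : nat) (P : protocol B) (V : finType) (e : rel V)
    (s : V) (m : message) (t : nat) : rat :=
  uniform_prob (fun w : t.-tuple (coins P V) => delivered m (run e s m w)).

(* Main.v *)
(** Collision detection turns every round into a beep: silence, exactly one
    transmitter and several transmitters can be told apart.  A beep wave from
    the source first gives every node its distance from it.  The layers are
    cut into rings of [w], about [D / log^3 n], consecutive layers, and in each
    ring, bottom-up, ranks are computed such that every node [v] below the top
    of a ring has, in the layer above, either a neighbour of larger rank or
    exactly one neighbour that has the same rank and is marked [fs].  A node of
    rank [r+1] owns two nodes of rank [r] in the next layer, or a node of rank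
    [r+1] that owns two such nodes further down, and so on; hence [2^rank <= n].

    To rank a layer, the red nodes (the layer) are thinned out to cover the
    blue nodes (the nodes of rank [r] in the next layer).  Random subsets of the
    red nodes beep; a blue node that hears exactly one of them is recruited by
    it and answers, and collision detection tells a red node whether it
    recruited 0, 1 or more blue nodes.  Red nodes with two recruits get rank
    [r+1], red nodes without recruits leave, and a red node with a single
    recruit leaves when it lost a coin toss and its recruit has another red
    neighbour that won it.  A red node that is not the only red neighbour of
    some blue node survives with probability at most [3/4], so after [O(log n)]
    epochs every red node left has a private blue node: it gets rank [r] and
    the mark [fs].  Different ranks are processed in different layers at the
    same time, so a ring costs [O(w log^3 n)] rounds.

    The message then follows a deterministic timetable: nodes of layer [l] and
    rank [r] know it by slot [slot l r].  Marked nodes send it down once, in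
    that slot, without interference from equal ranks, and all nodes run Decay
    for [O(log^2 n)] slots to reach smaller ranks.  A path from the source loses
    rank at most [log n] times in each of the [O(log^3 n)] rings, which gives
    [O(D + log^6 n)] rounds. *)
Require Import Defs.
From mathcomp Require Import all_boot all_order all_algebra.
From mathcomp Require Import boolp zify lra.

Set Implicit Arguments.
Unset Strict Implicit.
Unset Printing Implicit Defensive.
Import Order.TTheory GRing.Theory Num.Theory.

(** * Programs and their execution *)

Section Average.
Local Open Scope ring_scope.
Variable T : finType.
Hypothesis T0 : (0 < #|T|)%N.

Definition avg (f : T -> rat) : rat := (\sum_x f x) / #|T|%:R.

Lemma card_natr_gt0 : (0 : rat) < #|T|%:R. Proof. by rewrite ltr0n. Qed.

Lemma eq_avg f g : f =1 g -> avg f = avg g.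
Proof. by move=> fg; rewrite /avg (eq_bigr g). Qed.

Lemma avg_le f g : (forall x, f x <= g x) -> avg f <= avg g.
Proof. by move=> fg; rewrite ler_pM2r ?invr_gt0 ?card_natr_gt0 // ler_sum. Qed.

Lemma avg_const c : avg (fun=> c) = c.
Proof.
rewrite /avg sumr_const -[c *+ _]mulr_natr mulfK //.
exact/lt0r_neq0/card_natr_gt0.
Qed.

Lemma avg_le_const f c : (forall x, f x <= c) -> avg f <= c.
Proof. by move=> fc; rewrite -(avg_const c); apply: avg_le. Qed.

Lemma avg_sum (I : finType) (P : pred I) (f : I -> T -> rat) :
  avg (fun x => \sum_(i | P i) f i x) = \sum_(i | P i) avg (f i).
Proof. by rewrite /avg exchange_big /= mulr_suml. Qed.

Lemma avgD f g : avg (fun x => f x + g x) = avg f + avg g.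
Proof. by rewrite /avg big_split /= mulrDl. Qed.

Lemma avgZ c f : avg (fun x => c * f x) = c * avg f.
Proof. by rewrite /avg -mulr_sumr mulrA. Qed.

End Average.

(** Independence of the coins of different nodes, in the form in which the coin computations for
    Decay and for the coin toss use it. *)
Lemma avg_ffun (I T : finType) (f : I -> T -> rat) :
  (0 < #|T|)%N ->
  (avg (fun w : {ffun I -> T} => \prod_i f i (w i)) = \prod_i avg (f i))%R.
Proof.
move=> T0; rewrite /avg big_split /= -bigA_distr_bigA /=; congr (_ * _)%R.
by rewrite prodr_const card_ffun cardE -cardE natrX exprVn.
Qed.

(** * Programs as lists of instructions: expectations, invariants, failure probabilities *)

Section Program.
Variables (B nb : nat) (S : Type).

(** One round without a round number: a program is a list of instructions, and the counter that
    selects the current one is added only in [prog_protocol]. *)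
Record instr := Instr {
  iact : S -> nb.-tuple bool -> option (packet B);
  iupd : S -> nb.-tuple bool -> feedback B -> S
}.

Definition idle : instr := Instr (fun _ _ => None) (fun s _ _ => s).

Variables (V : finType) (e : rel V).
Definition config0 := V -> S.
Definition cointype := {ffun V -> nb.-tuple bool}.

Lemma tuple_gt0 : (0 < #|{: nb.-tuple bool}|)%N.
Proof. by rewrite card_tuple expn_gt0 card_bool. Qed.

Lemma coin_gt0 : (0 < #|{: cointype}|)%N.
Proof. by rewrite card_ffun expn_gt0 tuple_gt0. Qed.

Definition gstep (i : instr) (st : config0) (w : cointype) : config0 :=
  fun v => iupd i (st v) (w v) (hear e (fun u => iact i (st u) (w u)) v).

(** [Ex] and [alw] recurse from the first instruction, so the rest of a program is always analysed
    from the configuration reached so far and no probability space of whole runs is needed. *)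
Fixpoint Ex (p : seq instr) (f : config0 -> rat) (st : config0) : rat :=
  if p is i :: p' then avg (fun w => Ex p' f (gstep i st w)) else f st.

Fixpoint alw (p : seq instr) (Q : config0 -> Prop) (st : config0) : Prop :=
  if p is i :: p' then forall w, alw p' Q (gstep i st w) else Q st.

Lemma Ex_cat p q f st : Ex (p ++ q) f st = Ex p (Ex q f) st.
Proof. by elim: p st => //= i p IH st; apply: eq_avg => w; rewrite IH. Qed.

Lemma alw_cat p q Q st : alw (p ++ q) Q st <-> alw p (alw q Q) st.
Proof.
by elim: p st => //= i p IH st; split=> H w; apply/IH; apply: H.
Qed.

Lemma alw_imp p (Q Q' : config0 -> Prop) st :
  (forall st', Q st' -> Q' st') -> alw p Q st -> alw p Q' st.
Proof. by move=> QQ'; elim: p st => /= [|i p IH] st; auto. Qed.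

Lemma alw_and p (Q Q' : config0 -> Prop) st :
  alw p Q st -> alw p Q' st -> alw p (fun s => Q s /\ Q' s) st.
Proof. by elim: p st => /= [|i p IH] st; auto. Qed.

Lemma alw_true p (Q : config0 -> Prop) st : (forall st', Q st') -> alw p Q st.
Proof. by move=> H; elim: p st => /=. Qed.

Lemma alw_iota (body : nat -> seq instr) (Inv : nat -> config0 -> Prop) a n st :
  (forall i st, a <= i < a + n -> Inv i st -> alw (body i) (Inv i.+1) st) ->
  Inv a st ->
  alw (flatten [seq body i | i <- iota a n]) (Inv (a + n)) st.
Proof.
elim: n a st => [|n IH] a st H Hst; first by rewrite addn0.
rewrite /=; apply/alw_cat; apply: alw_imp (H a _ _ Hst); last by lia.
move=> st' Hst'; rewrite addnS -addSn; apply: IH => // i st'' ai.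
by apply: H; lia.
Qed.

Lemma alw_pres (X : Type) (g : S -> X) p st :
  (forall i, List.In i p -> forall s w fb, g (iupd i s w fb) = g s) ->
  alw p (fun st' => forall v, g (st' v) = g (st v)) st.
Proof.
elim: p st => //= i p IH st H w.
apply: alw_imp (IH _ _) => [st' Hst' v|j Hj]; last by apply: H; right.
by rewrite Hst' H //; left.
Qed.

Lemma Ex_le p f g st :
  alw p (fun s => f s <= g s)%R st -> (Ex p f st <= Ex p g st)%R.
Proof.
elim: p st => //= i p IH st H; apply: avg_le => [|w]; first exact: coin_gt0.
exact: IH.
Qed.

Lemma Ex_mono p f g st :
  (forall s, f s <= g s)%R -> (Ex p f st <= Ex p g st)%R.
Proof. by move=> fg; apply: Ex_le; apply: alw_true. Qed.

Lemma Ex_const p c st : Ex p (fun=> c) st = c.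
Proof.
elim: p st => //= i p IH st; rewrite (eq_avg (g := fun=> c)) ?avg_const //.
exact: coin_gt0.
Qed.

Lemma eq_Ex p f g st : f =1 g -> Ex p f st = Ex p g st.
Proof. by move=> fg; elim: p st => //= i p IH st; apply: eq_avg. Qed.

Lemma Ex_le_const p f c st :
  alw p (fun s => f s <= c)%R st -> (Ex p f st <= c)%R.
Proof. by move=> H; rewrite -(Ex_const p c st); apply: Ex_le. Qed.

Lemma ExD p f g st : (Ex p (fun s => f s + g s) st = Ex p f st + Ex p g st)%R.
Proof.
by elim: p st => //= i p IH st; rewrite -avgD; apply: eq_avg.
Qed.

Lemma ExZ p c f st : (Ex p (fun s => c * f s) st = c * Ex p f st)%R.
Proof.
by elim: p st => //= i p IH st; rewrite -avgZ; apply: eq_avg.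
Qed.

Lemma Ex_sum (I : finType) (P : pred I) (f : I -> config0 -> rat) p st :
  (Ex p (fun s => \sum_(i | P i) f i s) st = \sum_(i | P i) Ex p (f i) st)%R.
Proof.
by elim: p st => //= i p IH st; rewrite -avg_sum; apply: eq_avg.
Qed.

Definition fail (p : seq instr) (Q : config0 -> Prop) st : rat :=
  Ex p (fun s => (~~ `[< Q s >])%:R)%R st.

Lemma fail_le1 p Q st : (fail p Q st <= 1)%R.
Proof. by apply: Ex_le_const; apply: alw_true => s; rewrite lern1 leq_b1. Qed.

Lemma fail_alw p (Q : config0 -> Prop) st : alw p Q st -> (fail p Q st <= 0)%R.
Proof.
move=> H; apply: Ex_le_const; apply: alw_imp H => s Qs.
by have -> : `[< Q s >] by apply/asboolP.
Qed.

Lemma fail_imp p (Q Q' : config0 -> Prop) st :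
  alw p (fun s => Q s -> Q' s) st -> (fail p Q' st <= fail p Q st)%R.
Proof.
move=> H; apply: Ex_le; apply: alw_imp H => s QQ'; rewrite ler_nat.
by case: asboolP => //= nQ'; case: asboolP => //= Qs; case: nQ'; apply: QQ'.
Qed.

(** Union bound for consecutive phases: the second bound is uniform over the configurations
    satisfying [Q]; elsewhere the second phase is bounded by 1, which the failure of [Q] pays
    for. *)
Lemma fail_cat p q (Q Q' : config0 -> Prop) e1 e2 st :
  (0 <= e2)%R -> (fail p Q st <= e1)%R ->
  (forall s, Q s -> (fail q Q' s <= e2)%R) ->
  (fail (p ++ q) Q' st <= e1 + e2)%R.
Proof.
move=> e20 H1 H2; rewrite /fail Ex_cat.
apply: le_trans (_ : Ex p (fun s => (~~ `[< Q s >])%:R + e2)%R st <= _)%R.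
  apply: Ex_mono => s; case: asboolP => Qs /=.
    by rewrite add0r; apply: H2.
  by apply: le_trans (fail_le1 q Q' s) _; lra.
by rewrite ExD Ex_const; apply: lerD.
Qed.

Lemma fail_and p (Q Q' : config0 -> Prop) st :
  (fail p (fun s => Q s /\ Q' s) st <= fail p Q st + fail p Q' st)%R.
Proof.
rewrite /fail -ExD; apply: Ex_mono => s.
by do 3!case: asboolP => //=; move=> h1 h2 h3; try tauto.
Qed.

Lemma fail_iota (body : nat -> seq instr) (Inv : nat -> config0 -> Prop) ep a n st :
  (0 <= ep)%R ->
  (forall i st, a <= i < a + n -> Inv i st -> (fail (body i) (Inv i.+1) st <= ep)%R) ->
  Inv a st ->
  (fail (flatten [seq body i | i <- iota a n]) (Inv (a + n)%N) st <= n%:R * ep)%R.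
Proof.
move=> ep0; elim: n a st => [|n IH] a st H Hst.
  by rewrite addn0 mul0r; apply: fail_alw.
rewrite /= -natr1 mulrDl mul1r addrC.
apply: (fail_cat (Q := Inv a.+1)) => [||s Hs].
- by rewrite mulr_ge0.
- by apply: H => //; lia.
- rewrite addnS -addSn; apply: IH => // i st'' ai.
  by apply: H; lia.
Qed.

Lemma Ex_nseq_idle n f st : Ex (nseq n idle) f st = f st.
Proof. by elim: n => //= n IH; rewrite (eq_avg (g := fun=> f st)) ?avg_const ?coin_gt0. Qed.

End Program.
Arguments gstep : simpl never.

Definition fbn (B : nat) (f : feedback B) : nat :=
  match f with Nothing => 0 | Received _ => 1 | Collision => 2 end.

Lemma hearE (B : nat) (V : finType) (e : rel V) (acts : V -> option (packet B)) v :
  acts v = None ->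
  fbn (hear e acts v) = minn 2 #|[set u | e v u && isSome (acts u)]|.
Proof.
move=> av; rewrite /hear av.
have -> : #|[set u | e v u && isSome (acts u)]| =
    size (pmap acts [seq u <- enum V | e v u]).
  rewrite size_pmap count_filter cardE -size_filter; congr size.
  rewrite /enum_mem -filter_predI; apply: eq_filter => u.
  by rewrite /= !inE andbC andbT.
by case: (pmap _ _) => [|x [|y s]] //=; lia.
Qed.

Lemma hearR (B : nat) (V : finType) (e : rel V) (acts : V -> option (packet B)) v u x :
  acts v = None -> acts u = Some x ->
  [set u | e v u && isSome (acts u)] = [set u] ->
  hear e acts v = Received x.
Proof.
move=> av au E; rewrite /hear av.
have -> : pmap acts [seq u <- enum V | e v u] =
    pmap acts (enum [set u | e v u && isSome (acts u)]).
  have -> : enum [set u | e v u && isSome (acts u)] =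
      [seq u <- [seq u <- enum V | e v u] | isSome (acts u)].
    rewrite /enum_mem -!filter_predI; apply: eq_filter => z.
    by rewrite /= !inE andbT andbC.
  elim: [seq _ <- _ | e v _] => //= z s IH.
  by case E2: (acts z) => /=; rewrite ?E2 /= IH.
by rewrite E enum_set1 /= au.
Qed.

(** * Rounds in which only the number of beeping neighbours, capped at 2, matters *)

Section Beep.
Variables (B nb : nat) (S : Type).
Definition beep (a : S -> nb.-tuple bool -> bool)
    (u : S -> nb.-tuple bool -> nat -> S) : instr B nb S :=
  Instr (fun s w => if a s w then Some [tuple of nseq B false] else None)
        (fun s w f => u s w (fbn f)).

Definition nbeep (V : finType) (e : rel V) (tx : pred V) (v : V) : nat :=
  if tx v then 0 else minn 2 #|[set u | e v u && tx u]|.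

Lemma gstep_beep (V : finType) (e : rel V) a u (st : V -> S) w v :
  gstep e (beep a u) st w v =
  u (st v) (w v) (nbeep e (fun x => a (st x) (w x)) v).
Proof.
rewrite /gstep /= /nbeep; case av : (a (st v) (w v)).
  by congr u; rewrite /hear av.
rewrite hearE ?av //; congr (u _ _ (minn 2 _)).
by apply: eq_card => x; rewrite !inE; case: (a _ _).
Qed.

Lemma nbeep_gt0 (V : finType) (e : rel V) (tx : pred V) v :
  ~~ tx v -> reflect (exists2 u, e v u & tx u) (0 < nbeep e tx v).
Proof.
move=> /negbTE txv; rewrite /nbeep txv leq_min /=.
apply: (iffP card_gt0P) => [[u]|[u h1 h2]].
  by rewrite inE => /andP[]; exists u.
by exists u; rewrite inE h1.
Qed.

Lemma nbeep_eq1 (V : finType) (e : rel V) (tx : pred V) v :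
  ~~ tx v -> (nbeep e tx v == 1) = (#|[set u | e v u && tx u]| == 1).
Proof. by move=> /negbTE txv; rewrite /nbeep txv; lia. Qed.

End Beep.
Arguments nbeep : simpl never.
Arguments beep {B nb S}.
Arguments idle {B nb S}.

(** * From programs to protocols *)

Section Embedding.
Variables (B nb : nat) (S : Type) (p : seq (instr B nb S)).
Variables (i0 : option message -> S) (out : S -> option message).

(** Past the end of the program the default [idle] keeps the state, so the output stays valid in all
    later rounds. *)
Definition prog_protocol : protocol B := {|
  state := nat * S;
  ncoins := nb;
  init := fun x => (0, i0 x);
  act := fun s w => iact (nth idle p s.1) s.2 w;
  update := fun s w f => (s.1.+1, iupd (nth idle p s.1) s.2 w f);
  output := fun s => out s.2 |}.

Variables (V : finType) (e : rel V).

Lemma big_tuple_cons (T : finType) t (F : t.+1.-tuple T -> rat) :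
  (\sum_w F w = \sum_(x : T) \sum_(w : t.-tuple T) F [tuple of x :: w])%R.
Proof.
rewrite pair_big /=.
rewrite (reindex (fun q : T * t.-tuple T => [tuple of q.1 :: q.2])) //=.
exists (fun w : t.+1.-tuple T => (thead w, [tuple of behead w])).
  by move=> [x w] _; congr pair; apply/val_inj.
by move=> w _; rewrite /= -tuple_eta.
Qed.

(** Summing over the coins of the first round first turns the average over coin sequences into the
    nested averages of [Ex]. *)
Lemma run_Ex t k st (f : config prog_protocol V -> rat) :
  avg (fun w : t.-tuple (coins prog_protocol V) =>
         f (foldl (@round B prog_protocol V e) (fun v => (k, st v)) w)) =
  Ex e [seq nth idle p i | i <- iota k t]
     (fun st' => f (fun v => (k + t, st' v))) st.
Proof.
elim: t k st => [|t IH] k st /=.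
  rewrite addn0 (eq_avg (g := fun=> f (fun v => (k, st v)))).
    by rewrite avg_const // card_tuple.
  by move=> w; rewrite tuple0.
rewrite [LHS]/avg big_tuple_cons card_tuple expnS natrM invfM mulrA.
rewrite [X in _ = X]/avg mulrAC; congr (_ / _)%R.
rewrite mulr_suml; apply: eq_bigr => w0 _ /=.
rewrite addnS -addSn -IH /avg card_tuple; congr (_ / _)%R.
Qed.

Lemma delivery_prob_fail s m t :
  size p <= t ->
  (1 - fail e p (fun st => forall v, out (st v) = Some m)
         (fun v => i0 (if v == s then Some m else None))
   <= delivery_prob prog_protocol e s m t)%R.
Proof.
move=> pt; rewrite /delivery_prob /uniform_prob.
set st0 := (X in fail _ _ _ X).
pose f (c : config prog_protocol V) : rat := ((delivered m c)%:R)%R.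
have -> : ((#|[set x : t.-tuple (coins prog_protocol V) | delivered m (run e s m x)]|%:R
           / #|{: t.-tuple (coins prog_protocol V)}|%:R)%R = 
  avg (fun w : t.-tuple (coins prog_protocol V) =>
         f (foldl (@round B prog_protocol V e) (fun v => (0, st0 v)) w))).
  rewrite /avg; congr (_ / _)%R.
  rewrite -sum1_card natr_sum big_mkcond /=; apply: eq_bigr => w _.
  rewrite inE.
  have -> : @run B prog_protocol V e s m t w =
    foldl (@round B prog_protocol V e) (fun v => (0, st0 v)) w by [].
  by rewrite /f; case: (delivered m _).
rewrite run_Ex.
have -> : [seq nth idle p i | i <- iota 0 t] = p ++ nseq (t - size p) idle.
  apply: (@eq_from_nth _ idle).
    by rewrite size_map size_iota size_cat size_nseq subnKC.
  move=> i; rewrite size_map size_iota => it.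
  rewrite (nth_map 0) ?size_iota // nth_iota // add0n nth_cat nth_nseq.
  by case: ltnP => // pi; rewrite nth_default //; case: ifP.
rewrite Ex_cat lerBlDr /fail -ExD -[X in (X <= _)%R](Ex_const e p 1%R st0).
apply: Ex_mono => st'; rewrite Ex_nseq_idle /f /delivered.
case: asboolP => [H|_]; last by rewrite lerDr ler0n.
by have -> : [forall v, out (st' v) == Some m] by apply/forallP => v; rewrite H.
Qed.

End Embedding.

(** * Decay *)

(** An event of probability 2^-j for [j <= nb]: the transmission probability of Decay at scale
    [j]. *)
Definition low (nb j : nat) (b : nb.-tuple bool) : bool := all id (take j b).

(* Upper bound on the probability that a Decay round at the right scale fails. *)
Definition dr : rat := (15/16)%R.

Lemma dr_ge0 : (0 <= dr)%R. Proof. by rewrite /dr; lra. Qed.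
Lemma dr_le1 : (dr <= 1)%R. Proof. by rewrite /dr; lra. Qed.
Lemma dr_exp_ge0 n : (0 <= dr ^+ n)%R. Proof. exact/exprn_ge0/dr_ge0. Qed.

(* Expected fraction of the non-isolated red nodes that survive an epoch. *)
Definition hr : rat := (3/4)%R.

Lemma hr_ge0 : (0 <= hr)%R. Proof. by rewrite /hr; lra. Qed.
Lemma hr_exp_ge0 n : (0 <= hr ^+ n)%R. Proof. exact/exprn_ge0/hr_ge0. Qed.

Section Coins.
Local Open Scope ring_scope.

Lemma avg_low nb j : (j <= nb)%N ->
  avg (fun b : nb.-tuple bool => (low j b)%:R) = (2 ^+ j)^-1.
Proof.
rewrite /avg card_tuple card_bool natrX.
have H (n : nat) : (2 : rat) ^+ n != 0 by apply: expf_neq0.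
suff: (j <= nb)%N -> (\sum_(b : nb.-tuple bool) (low j b)%:R : rat) = 2 ^+ nb / 2 ^+ j.
  by move=> E jn; rewrite E // mulrAC divff // mul1r.
elim: nb j => [|nb IH] [|j] // jn.
- rewrite divff // (eq_bigr (fun=> 1)); last by move=> b _; rewrite /low take0.
  by rewrite sumr_const card_tuple.
- rewrite expr0 divr1 (eq_bigr (fun=> 1)); last by move=> b _; rewrite /low take0.
  by rewrite sumr_const card_tuple card_bool natrX.
- rewrite big_tuple_cons big_bool /= [X in _ + X]big1 => [|b _]; last first.
    by rewrite /low.
  rewrite addr0 (eq_bigr (fun b : nb.-tuple bool => (low j b)%:R)) // IH //.
  by rewrite !exprS invfM mulrACA divff ?mul1r.
Qed.

Lemma avg_notlow nb j : (j <= nb)%N ->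
  avg (fun b : nb.-tuple bool => (~~ low j b)%:R) = 1 - (2 ^+ j)^-1.
Proof.
move=> jn; rewrite -(avg_low jn).
apply/eqP; rewrite eq_sym subr_eq -avgD; apply/eqP.
rewrite (eq_avg (g := fun=> 1)); first by rewrite avg_const ?tuple_gt0.
by move=> b; case: low; rewrite ?addr0 ?add0r.
Qed.

(** The power does not decrease with [j], because (1 - x/2)^2 >= 1 - x, and it starts at 1/4. *)
Lemma one_sub_pow2_ge j :
  (1 - (2 ^+ j.+1)^-1 : rat) ^+ (2 ^ j.+1)%N >= 1/4.
Proof.
elim: j => [|j IH]; first by rewrite expr1 expn1 expr2; lra.
apply: le_trans IH _; rewrite (expnS 2 j.+1) exprM lerXn2r ?nnegrE //.
- by rewrite subr_ge0 invf_le1 ?exprn_gt0 // exprn_ege1.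
- exact: sqr_ge0.
- rewrite (exprS 2 j.+1) invfM; set x := (2 ^+ j.+1)^-1.
  have : 0 <= x ^+ 2 by exact: sqr_ge0.
  by rewrite !expr2; lra.
Qed.

(** With x = 2^-j, the factor d * x is at least 1, and the exponent is at most twice 2^j, so the
    power is at least (1/4)^2; scale 0 is treated apart. *)
Lemma decay_bound j d : (2 ^ j <= d < 2 ^ j.+1)%N ->
  1/16 <= d%:R * (2 ^+ j)^-1 * (1 - (2 ^+ j)^-1 : rat) ^+ d.-1.
Proof.
case: j => [|j] jd.
  have -> : d = 1%N by lia.
  by rewrite expr0 invr1.
set x : rat := (2 ^+ j.+1)^-1.
have x0 : 0 < x by rewrite invr_gt0 exprn_gt0.
have x1 : x <= 1 by rewrite invf_le1 ?exprn_gt0 // exprn_ege1.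
have dx : 1 <= d%:R * x.
  rewrite ler_pdivlMr ?exprn_gt0 // mul1r -natrX ler_nat; lia.
apply: le_trans (_ : (1 - x) ^+ d.-1 <= _); last first.
  by rewrite ler_peMl // exprn_ge0 // subr_ge0.
apply: le_trans (_ : (1 - x) ^+ (2 ^ j.+1 * 2)%N <= _); last first.
  rewrite ler_wiXn2l ?subr_ge0 ?gerBl ?(ltW x0) //.
  by move: jd; rewrite (expnS _ j.+1); lia.
rewrite exprM; have := one_sub_pow2_ge j; rewrite -/x.
rewrite expr2; set y := _ ^+ _ => y4.
by apply: le_trans (ler_pM _ _ y4 y4); lra.
Qed.

Variables (V : finType) (nb : nat).

Lemma avg_decay (X : {set V}) j : (j <= nb)%N ->
  (2 ^ j <= #|X| < 2 ^ j.+1)%N ->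
  avg (fun w : {ffun V -> nb.-tuple bool} =>
    (#|[set u in X | low j (w u)]| != 1)%N%:R) <= dr.
Proof.
move=> jn Xj.
have W0 : (0 < #|{ffun V -> nb.-tuple bool}|)%N by rewrite card_ffun expn_gt0 tuple_gt0.
(* The product of [f u v (w v)] over [v] is, for [u] in [X], the indicator that [u] is the only node
   of [X] that transmits. *)
pose f (u v : V) (b : nb.-tuple bool) : rat :=
  if v == u then (low j b)%:R else if v \in X then (~~ low j b)%:R else 1.
have Ef u : u \in X -> avg (fun w : {ffun V -> nb.-tuple bool} => \prod_v f u v (w v))
    = (2 ^+ j)^-1 * (1 - (2 ^+ j)^-1) ^+ #|X|.-1.
  move=> uX; rewrite avg_ffun ?tuple_gt0 // (bigD1 u) //= /f eqxx avg_low //.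
  congr (_ * _); rewrite (cardsD1 u X) uX add1n /= -prodr_const big_mkcond /=.
  rewrite [RHS]big_mkcond /=; apply: eq_bigr => v _.
  rewrite !inE; case: eqP => //= _; case: ifP => _.
    exact: avg_notlow.
  by rewrite avg_const ?tuple_gt0.
(* These events exclude each other for different [u], so their probabilities add up. *)
have H : \sum_(u in X) avg (fun w : {ffun V -> nb.-tuple bool} => \prod_v f u v (w v))
    <= avg (fun w : {ffun V -> nb.-tuple bool} => (#|[set u in X | low j (w u)]| == 1)%N%:R).
  rewrite -avg_sum; apply: avg_le => // w.
  have [/cards1P[u Eu]|n1] := boolP (#|_| == 1)%N.
    have uX : u \in X by move: (set11 u); rewrite -Eu inE; case/andP.
    rewrite (bigD1 u) //= [X in _ + X]big1 ?addr0 => [|v /andP[vX vu]].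
      apply: prodr_ile1 => v _; rewrite /f.
      by case: ifP => _; [|case: ifP => _]; rewrite ?ler0n ?lern1 ?leq_b1 ?ler01 ?lexx.
    rewrite (bigD1 v) //= /f eqxx.
    have : v \notin [set u in X | low j (w u)] by rewrite Eu inE.
    by rewrite inE vX /= => /negbTE ->; rewrite mul0r.
  rewrite big1 // => u uX; apply/eqP; rewrite prodf_seq_eq0; apply/hasP.
  have [lu|nlu] := boolP (low j (w u)); last first.
    by exists u; rewrite ?mem_index_enum //= /f eqxx (negbTE nlu).
  have : [set u in X | low j (w u)] != [set u].
    by apply: contra n1 => /eqP ->; rewrite cards1.
  rewrite eqEsubset sub1set inE uX lu /= !andbT => /subsetPn[v].
  rewrite !inE => /andP[vX lv] vu.
  by exists v; rewrite ?mem_index_enum //= /f (negbTE vu) vX lv.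
have D := decay_bound Xj.
rewrite (eq_bigr _ Ef) sumr_const -(mulr_natl _ #|X|) mulrA in H.
set g := (X in avg X <= _).
have : avg g + avg (fun w : {ffun V -> nb.-tuple bool} =>
    (#|[set u in X | low j (w u)]| == 1)%N%:R) = 1.
  rewrite -avgD (eq_avg (g := fun=> 1)) ?avg_const // => w.
  by rewrite /g; case: eqP; rewrite ?addr0 ?add0r.
by move=> E; move: (le_trans D H) E; rewrite /dr; set a := avg _; set b := avg _; lra.
Qed.

Lemma avg_halve (u u' : V) : (0 < nb)%N -> u != u' ->
  avg (fun w : {ffun V -> nb.-tuple bool} => (low 1 (w u) && ~~ low 1 (w u'))%:R) = 1/4.
Proof.
move=> nb0 uu'.
pose f (v : V) (b : nb.-tuple bool) : rat :=
  if v == u then (low 1 b)%:R else if v == u' then (~~ low 1 b)%:R else 1.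
transitivity (avg (fun w : {ffun V -> nb.-tuple bool} => \prod_v f v (w v))).
  apply: eq_avg => w; rewrite (bigD1 u) //= (bigD1 u') 1?eq_sym //= big1 => [|v].
    rewrite /f !eqxx (negbTE (_ : u' != u)) 1?eq_sym // mulr1 -natrM.
    by rewrite mulnb.
  by rewrite /f => /andP[/negbTE -> /negbTE ->].
rewrite avg_ffun ?tuple_gt0 // (bigD1 u) //= (bigD1 u') 1?eq_sym //= big1 => [|v].
  rewrite /f !eqxx (negbTE (_ : u' != u)) 1?eq_sym // mulr1.
  by rewrite avg_low // avg_notlow.
by rewrite /f => /andP[/negbTE -> /negbTE ->]; rewrite avg_const ?tuple_gt0.
Qed.

Lemma avg_half (u : V) : (0 < nb)%N ->
  avg (fun w : {ffun V -> nb.-tuple bool} => (low 1 (w u))%:R) = 1/2.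
Proof.
move=> nb0; pose f (v : V) (b : nb.-tuple bool) : rat :=
  if v == u then (low 1 b)%:R else 1.
transitivity (avg (fun w : {ffun V -> nb.-tuple bool} => \prod_v f v (w v))).
  apply: eq_avg => w; rewrite (bigD1 u) //= big1 => [|v].
    by rewrite /f !eqxx mulr1.
  by rewrite /f => /negbTE ->.
rewrite avg_ffun ?tuple_gt0 // (bigD1 u) //= big1 => [|v].
  by rewrite /f eqxx mulr1 avg_low.
by rewrite /f => /negbTE ->; rewrite avg_const ?tuple_gt0.
Qed.

End Coins.

Lemma scale_exists d lam : 0 < d <= 2 ^ lam ->
  exists2 j, j <= lam & 2 ^ j <= d < 2 ^ j.+1.
Proof.
case/andP=> d0 dl; exists (trunc_log 2 d); last exact: trunc_log_bounds.
by rewrite -(@leq_exp2l 2) //; apply: leq_trans (trunc_logP _ _) dl.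
Qed.

Lemma count_scale j La q : j < La ->
  count (fun i => i %% La == j) (iota 0 (La * q)) = q.
Proof.
move=> jL; elim: q => [|q IH]; first by rewrite muln0.
rewrite mulnS addnC iotaD count_cat IH add0n -[in RHS]addn1; congr (_ + _).
rewrite -[X in iota X _]addn0 iotaDl count_map (eq_in_count (a2 := pred1 j)) => [|i].
  by rewrite count_uniq_mem ?iota_uniq // mem_iota jL.
by rewrite mem_iota /= => iL; rewrite mulnC modnMDl modn_small.
Qed.

(** * Recruiting *)

(* [inR], [inA]: the node is an active red, resp. blue, node.  [smp]: the
   operations in which a red node beeped.  [asg]: the operation in which a blue
   node was recruited; the recruiter is its only red neighbour [u] with this
   operation in [smp u].  [cnt]: the number of recruits of a red node, exact
   up to 1. *)
Record node (B : nat) := Node {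
  lay : nat; rk : nat; fs : bool;
  inR : bool; inA : bool;
  smp : seq nat; asg : option nat; cnt : nat; flg : bool;
  msg : option message; buf : seq (packet B) }.

Arguments Node {B}.

Section Process.
Variables (B nb La q : nat).
Variables (red : nat -> bool) (rr : nat -> nat) (blue : nat -> nat -> bool).

Notation node := (node B).
Notation instr := (instr B nb node).

Definition setp (s : node) rk' fs' R A sm a c f : node :=
  Node (lay s) rk' fs' R A sm a c f (msg s) (buf s).

Definition i_init : instr :=
  beep (fun _ _ => false) (fun s _ _ =>
    setp s (rk s) (fs s) (red (lay s)) (blue (lay s) (rk s)) [::] None 0 false).

Definition i_reset : instr :=
  beep (fun _ _ => false) (fun s _ _ =>
    setp s (rk s) (fs s) (inR s) (inA s) [::] None 0 false).

Definition i_op1 i : instr :=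
  beep (fun s w => inR s && low (i %% La) w) (fun s w n =>
    setp s (rk s) (fs s) (inR s) (inA s)
      (if inR s && low (i %% La) w then i :: smp s else smp s)
      (if [&& inA s, asg s == None & n == 1] then Some i else asg s)
      (cnt s) (flg s)).

Definition i_op2 i : instr :=
  beep (fun s _ => inA s && (asg s == Some i)) (fun s _ n =>
    setp s (rk s) (fs s) (inR s) (inA s) (smp s) (asg s)
      (if inR s && (i \in smp s) then cnt s + n else cnt s) (flg s)).

(** Blue nodes that hear a beep here have a red neighbour of larger rank and retire. The test on
    [rk] protects a larger rank obtained in an earlier step. *)
Definition i_prom : instr :=
  beep (fun s _ => inR s && (1 < cnt s)) (fun s _ n =>
    let p := [&& inR s, 1 < cnt s & rk s <= rr (lay s)] in
    setp s (if p then (rr (lay s)).+1 else rk s) (fs s && ~~ p)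
      (inR s && (cnt s == 1)) (inA s && (n == 0)) (smp s) (asg s) (cnt s) (flg s)).

(** Winners of the toss ([~~ low 1]) beep. Afterwards [flg] means that the toss was lost at a red
    node, and that some red neighbour won at a blue one. *)
Definition i_halve : instr :=
  beep (fun s w => inR s && ~~ low 1 w) (fun s w n =>
    setp s (rk s) (fs s) (inR s) (inA s) (smp s) (asg s) (cnt s)
      (if inR s then low 1 w else 0 < n)).

(* Only the red nodes that beeped in operation [k] listen to reply [k], so each
   of them hears exactly its own recruits. *)
Definition i_reply k : instr :=
  beep (fun s _ => (asg s == Some k) && (flg s || ~~ inA s)) (fun s _ n =>
    setp s (rk s) (fs s) (inR s && ~~ [&& flg s, k \in smp s & 0 < n]) (inA s)
      (smp s) (asg s) (cnt s) (flg s)).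

Definition i_fin : instr :=
  beep (fun _ _ => false) (fun s _ _ =>
    let p := inR s && (rk s <= rr (lay s)) in
    setp s (if p then rr (lay s) else rk s) (fs s || p) (inR s) false
      (smp s) (asg s) (cnt s) (flg s)).

Definition op i := [:: i_op1 i; i_op2 i].
Definition ops := flatten [seq op i | i <- iota 0 (La * q)].
Definition assign := i_reset :: ops ++ [:: i_prom].
Definition replies := flatten [seq [:: i_reply k] | k <- iota 0 (La * q)].
Definition epoch := assign ++ i_halve :: replies.
(* [q] is both the number of Decay repetitions and the number of epochs. *)
Definition proc := i_init :: flatten (nseq q epoch) ++ assign ++ [:: i_fin].

Variables (V : finType) (e : rel V).
Hypothesis e_sym : symmetric e.
Notation cfg := (V -> node).

Definition core (s : node) := (lay s, rk s, fs s, inR s, inA s, msg s).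

Definition rec (st : cfg) u v :=
  [&& inR (st u), inA (st v), e u v &
      if asg (st v) is Some k then k \in smp (st u) else false].

(** The second clause makes the recruiter of a blue node unique; the last one makes the counter
    exact up to the cap 2, which suffices to distinguish 0, 1 and more recruits. *)
Definition OpsInv i (st : cfg) := [/\
  forall v, asg (st v) != None -> inA (st v),
  forall v k, asg (st v) = Some k -> k < i /\
    #|[set u | [&& e v u, inR (st u) & k \in smp (st u)]]| = 1,
  forall u k, k \in smp (st u) -> k < i &
  forall u, inR (st u) -> minn 2 (cnt (st u)) = minn 2 #|[set v | rec st u v]|].

Definition disj (st : cfg) := forall v, inA (st v) -> ~~ inR (st v).

(** A blue node recruited now heard exactly one red neighbour, so a red node that beeped hears in
    the second round precisely its own new recruits, counted up to 2. *)
Lemma op_inv i st : disj st -> OpsInv i st -> alw e (op i) (OpsInv i.+1) st.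
Proof.
move=> D [H0 H1 H2 H3] w1 w2.
pose tx1 u := inR (st u) && low (i %% La) (w1 u).
pose new v := [&& inA (st v), asg (st v) == None & nbeep e tx1 v == 1].
set s1 := gstep e (i_op1 i) st w1; set s2 := gstep e (i_op2 i) s1 w2.
have E1 v : s1 v = setp (st v) (rk (st v)) (fs (st v)) (inR (st v)) (inA (st v))
  (if tx1 v then i :: smp (st v) else smp (st v))
  (if new v then Some i else asg (st v)) (cnt (st v)) (flg (st v)).
  by rewrite /s1 gstep_beep.
pose tx2 v := inA (s1 v) && (asg (s1 v) == Some i).
have E2 v : s2 v = setp (s1 v) (rk (s1 v)) (fs (s1 v)) (inR (s1 v)) (inA (s1 v))
  (smp (s1 v)) (asg (s1 v)) (if inR (s1 v) && (i \in smp (s1 v))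
     then cnt (s1 v) + nbeep e tx2 v else cnt (s1 v)) (flg (s1 v)).
  by rewrite /s2 gstep_beep.
clearbody s2; clearbody s1.
have isc u : i \in smp (s1 u) = tx1 u.
  rewrite E1 /=; case: ifP => _; first by rewrite inE eqxx.
  by apply/negP => /H2; rewrite ltnn.
have ksc u k : k < i -> k \in smp (s1 u) = (k \in smp (st u)).
  move=> ki; rewrite E1 /=; case: ifP => _ //; rewrite inE.
  by case: eqP => // Ek; move: ki; rewrite Ek ltnn.
have tx2E v : tx2 v = new v.
  rewrite /tx2 E1 /=; case: ifP => [/and3P[-> _ _]|_]; first by rewrite eqxx.
  apply/negP => /andP[_ /eqP /H1[]]; by rewrite ltnn.
split.
- move=> v; rewrite E2 /= E1 /=; case: ifP => [/and3P[]|_ /H0] //.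
- move=> v k; rewrite E2 /= => Ek.
  suff [ki Ec] : k < i.+1 /\ #|[set u | [&& e v u, inR (st u) & k \in smp (s1 u)]]| = 1.
    split=> //; rewrite -Ec; apply: eq_card => u.
    by rewrite !inE E2 /= E1 /=.
  move: Ek; rewrite E1 /=; case: ifP => [Hnew [<-]|_ Ek].
    split=> //; move: Hnew => /and3P[Av _]; rewrite nbeep_eq1; last first.
      by rewrite /tx1 (negbTE (D _ Av)).
    move=> /eqP Ec; rewrite -[RHS]Ec; apply: eq_card => u.
    by rewrite !inE isc /tx1; case: (inR _).
  have [ki Ec] := H1 _ _ Ek; split; first exact: leqW.
  by rewrite -Ec; apply: eq_card => u; rewrite !inE ksc.
- move=> u k; rewrite E2 /= E1 /=; case: ifP => _; last by move=> /H2; lia.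
  by rewrite inE => /orP[/eqP ->|/H2]; lia.
- move=> u; rewrite E2 /= E1 /= => Ru; rewrite Ru /=.
  have -> : (i \in (if tx1 u then i :: smp (st u) else smp (st u))) = tx1 u.
    by have := isc u; rewrite E1.
  have Erec v : rec s2 u v = rec st u v || [&& tx1 u, e u v & new v].
    rewrite /rec E2 /= E2 /= !E1 /= Ru /=.
    have [Hn|Hn] := boolP (new v); last first.
      rewrite !andbF orbF; case Ea: (asg (st v)) => [k|]; last by rewrite !andbF.
      have [ki _] := H1 _ _ Ea.
      by have := ksc u k ki; rewrite E1 /= => ->.
    have := isc u; rewrite E1 /= => ->.
    move: Hn => /and3P[-> /eqP -> _]; rewrite /= !andbF /= andbT.
    by rewrite andbC.
  case Et: (tx1 u); last first.
    by rewrite H3 //; congr minn; apply: eq_card => v; rewrite !inE Erec Et orbF.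
  (* Old and new recruits are disjoint, because a new recruit had no operation number before. *)
  have -> : #|[set v | rec s2 u v]| =
      #|[set v | rec st u v]| + #|[set v | e u v && new v]|.
    rewrite -cardsUI [X in _ + X]eq_card0 ?addn0 => [|v].
      by apply: eq_card => v; rewrite !inE Erec Et.
    rewrite !inE; apply/negP => /andP[/and4P[_ _ _ h1] /andP[_ /and3P[_ h2 _]]].
    by move: h1; rewrite (eqP h2).
  have -> : nbeep e tx2 u = minn 2 #|[set v | e u v && new v]|.
    rewrite /nbeep tx2E.
    have -> : new u = false.
      by apply/negP => /and3P[/D]; rewrite Ru.
    by congr minn; apply: eq_card => v; rewrite !inE tx2E.
  by have := H3 u Ru; lia.
Qed.

Lemma ops_core st : alw e ops (fun st' => forall v, core (st' v) = core (st v)) st.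
Proof.
apply: alw_pres => i Hi s w fb.
suff [k [->|->]] : exists k, i = i_op1 k \/ i = i_op2 k by [].
move: Hi; rewrite /ops; elim: (iota _ _) => //= k s' IH [|[|]]; auto.
  by move=> <-; exists k; left.
by move=> <-; exists k; right.
Qed.

Lemma alw_opsP i n st : disj st -> OpsInv i st ->
  alw e (flatten [seq op k | k <- iota i n]) (OpsInv (i + n)) st.
Proof.
move=> D H.
apply: alw_imp (_ : alw e _ (fun s => disj s /\ OpsInv (i + n) s) st); first by move=> ? [].
apply: (alw_iota (Inv := fun i s => disj s /\ OpsInv i s)) => // k s _ [Ds Hs].
apply: alw_and; last exact: op_inv.
apply: alw_imp (_ : alw e (op k) (fun st' => forall v, core (st' v) = core (s v)) s).
  move=> s' E v; have [_ _ _ -> -> _] := E v; exact: Ds.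
by apply: alw_pres => j [<-|[<-|]].
Qed.

Section Assigned.
Variable lam : nat.
Hypotheses (LaE : La = lam.+1) (Vlam : #|V| <= 2 ^ lam) (lamnb : lam <= nb).

Lemma op_unassigned i j st v :
  inA (st v) -> ~~ inR (st v) ->
  2 ^ j <= #|[set u | e v u && inR (st u)]| < 2 ^ j.+1 -> j < La ->
  (Ex e (op i) (fun s => (asg (s v) == None)%:R) st
   <= (if (i %% La == j)%N then dr else 1) * (asg (st v) == None)%:R)%R.
Proof.
move=> Av Rv Xj jLa.
case Ea: (asg (st v)) => [k|].
  rewrite [((Some k == None)%:R)%R](_ : _ = 0%R) // mulr0.
  apply: Ex_le_const => w1 w2; rewrite !gstep_beep /= Ea /=.
  by rewrite andbF.
rewrite [((None == None :> option nat)%:R)%R](_ : _ = 1%R) // mulr1.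
have [Ei|_] := eqVneq (i %% La) j; last first.
  by apply: Ex_le_const; apply: alw_true => s; rewrite lern1 leq_b1.
have lnb : i %% La <= nb by have := ltn_pmod i (leq_ltn_trans (leq0n j) jLa); lia.
have := @avg_decay V nb [set u | e v u && inR (st u)] _ lnb; rewrite Ei => /(_ Xj).
apply: le_trans; apply: avg_le => [|w1]; first exact: coin_gt0.
apply: avg_le_const => [|w2]; [exact: coin_gt0|rewrite !gstep_beep /= Av Ea /=].
rewrite nbeep_eq1 ?(negbTE Rv) // Ei ler_nat.
rewrite (_ : #|[set u in _ | _]| = #|[set u | e v u && (inR (st u) && low j (w1 u))]|).
  by case: ifP.
by apply: eq_card => u; rewrite !inE andbA.
Qed.

Lemma ops_unassigned st v :
  disj st -> inA (st v) -> (exists2 u, e v u & inR (st u)) ->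
  (Ex e ops (fun s => (asg (s v) == None)%:R) st <= dr ^+ q)%R.
Proof.
move=> D Av [u0 eu0 Ru0].
have [|j jl Xj] := @scale_exists #|[set u | e v u && inR (st u)]| lam.
  rewrite (leq_trans (max_card _) Vlam) andbT.
  by apply/card_gt0P; exists u0; rewrite inE eu0.
have jLa : j < La by rewrite LaE.
rewrite /ops -[in X in (_ <= X)%R](count_scale q jLa).
(* Generalised to all configurations with the same [core]: the operations do not change the red
   neighbourhood of [v], so [j] remains the right scale. *)
have : forall s, (forall v, core (s v) = core (st v)) ->
   (Ex e (flatten [seq op i | i <- iota 0 (La * q)]) (fun s => (asg (s v) == None)%:R) s
   <= dr ^+ count (fun i => i %% La == j)%N (iota 0 (La * q)%N) * (asg (s v) == None)%:R)%R.
  elim: (iota _ _) => [|i l IH] s Hs; first by rewrite mul1r.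
  have RE u : inR (s u) = inR (st u) by have [_ _ _ -> _ _] := Hs u.
  have AE u : inA (s u) = inA (st u) by have [_ _ _ _ -> _] := Hs u.
  rewrite -cat1s map_cat flatten_cat Ex_cat.
  apply: le_trans (_ : Ex e (op i) (fun s' => dr ^+ count (fun i => i %% La == j)%N l
      * (asg (s' v) == None)%:R)%R s <= _)%R.
    apply: (@Ex_le _ _ _ _ e (op i)).
    apply: alw_imp (_ : alw e (op i) (fun st' => forall v, core (st' v) = core (s v)) s).
      by move=> s' Hs'; apply: IH => x; rewrite Hs'.
    by apply: alw_pres => k [<-|[<-|]].
  have U : (Ex e (op i) (fun s' => (asg (s' v) == None)%:R) s
      <= (if (i %% La == j)%N then dr else 1) * (asg (s v) == None)%:R)%R.
    apply: op_unassigned; rewrite ?RE ?AE ?D //.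
    by rewrite (eq_card (B := [set u | e v u && inR (st u)])) // => u; rewrite !inE RE.
  have P0 : (0 <= dr ^+ count (fun i => i %% La == j)%N l)%R by exact: dr_exp_ge0.
  rewrite ExZ; apply: le_trans (ler_wpM2l P0 U) _.
  rewrite [count _ (i :: l)]/= exprD.
  move: (dr ^+ _)%R => c; move: (_%:R)%R => y.
  have -> : ((if (i %% La == j)%N then dr else 1) = dr ^+ (i %% La == j)%N)%R.
    by case: (_ == j).
  by rewrite mulrA [(c * _)%R]mulrC lexx.
move=> /(_ st (fun=> erefl)) /le_trans; apply.
by rewrite ler_piMr ?dr_exp_ge0 // lern1 leq_b1.
Qed.

End Assigned.
End Process.

(** * The outcome of one assignment phase *)

Section Epoch.
Variables (B nb La q : nat) (rr : nat -> nat).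
Variables (V : finType) (e : rel V).
Hypothesis e_sym : symmetric e.
Notation node := (node B).
Notation cfg := (V -> node).
Notation assign := (assign B nb La q rr).
Notation replies := (replies B nb La q).

Definition nrc (rc : rel V) u := #|[set v | rc u v]|.

(** Describes the phase from [s0] to [s2] through the recruitment relation [rc] instead of operation
    numbers. Only [pp_smp], [pp_idx] and [pp_asg] still mention these, for the replies and for the
    existence of a recruiter. *)
Record PostProm (s0 s2 : cfg) (rc : rel V) : Prop := {
  pp_rc : forall u v, rc u v -> [/\ inR (s0 u), inA (s0 v) & e u v];
  pp_uniq : forall u u' v, rc u v -> rc u' v -> u = u';
  pp_inR : forall u, inR (s2 u) = inR (s0 u) && (nrc rc u == 1);
  pp_inA : forall v, inA (s2 v) =
    inA (s0 v) && ~~ [exists u, [&& e v u, inR (s0 u) & 1 < nrc rc u]];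
  pp_same : forall v, lay (s2 v) = lay (s0 v) /\ msg (s2 v) = msg (s0 v);
  pp_rk : forall u, rk (s2 u) =
    if [&& inR (s0 u), 1 < nrc rc u & rk (s0 u) <= rr (lay (s0 u))]
    then (rr (lay (s0 u))).+1 else rk (s0 u);
  pp_fs : forall u, fs (s2 u) =
    fs (s0 u) && ~~ [&& inR (s0 u), 1 < nrc rc u & rk (s0 u) <= rr (lay (s0 u))];
  pp_smp : forall u v k, inR (s0 u) -> e u v -> asg (s2 v) = Some k ->
    k \in smp (s2 u) -> rc u v;
  pp_idx : forall u v, rc u v ->
    exists k, [/\ asg (s2 v) = Some k, k < La * q & k \in smp (s2 u)];
  pp_asg : forall v, asg (s2 v) != None -> inA (s0 v) /\ exists u, rc u v
}.

Lemma assign_post s0 : disj s0 ->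
  alw e assign (fun s2 => exists rc, PostProm s0 s2 rc) s0.
Proof.
move=> D w0; set s0' := gstep e _ s0 w0.
have E0 v : s0' v = setp (s0 v) (rk (s0 v)) (fs (s0 v)) (inR (s0 v)) (inA (s0 v)) [::] None 0 false.
  by rewrite /s0' gstep_beep.
clearbody s0'; apply/alw_cat.
have D' : disj s0' by move=> v; rewrite !E0; apply: D.
have O0 : OpsInv e 0 s0'.
  split=> [v|v k|u k|u]; rewrite ?E0 //= => _; congr minn.
  by rewrite eq_card0 // => v; rewrite !inE /rec E0 E0 /= !andbF.
have A := alw_and (alw_opsP nb La (La * q) D' O0) (ops_core nb La q e s0').
apply: alw_imp A => s1.
rewrite add0n => -[[H0 H1 H2 H3] C] w.
set s2 := gstep e _ s1 w.
have tx_cnt u : inR (s1 u) && (1 < cnt (s1 u)) = inR (s1 u) && (1 < nrc (rec e s1) u).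
  by case Ru: (inR _) => //=; have := H3 u Ru; rewrite /nrc; lia.
have eq1_cnt u : inR (s1 u) && (cnt (s1 u) == 1) = inR (s1 u) && (nrc (rec e s1) u == 1).
  by case Ru: (inR _) => //=; have := H3 u Ru; rewrite /nrc; lia.
pose tx u := inR (s1 u) && (1 < nrc (rec e s1) u).
have E2 v : s2 v =
  let s := s1 v in
  let p := tx v && (rk s <= rr (lay s)) in
    setp s (if p then (rr (lay s)).+1 else rk s) (fs s && ~~ p)
      (inR s && (nrc (rec e s1) v == 1)) (inA s && (nbeep e tx v == 0)) (smp s) (asg s) (cnt s) (flg s).
  rewrite /s2 gstep_beep /= eq1_cnt andbA tx_cnt; congr setp; congr (_ && (_ == _)).
  by rewrite /nbeep tx_cnt; congr (if _ then _ else minn _ _); apply: eq_card => u; rewrite !inE tx_cnt.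
clearbody s2.
have cl v : lay (s1 v) = lay (s0 v) by have := C v; rewrite E0 => -[].
have crk v : rk (s1 v) = rk (s0 v) by have := C v; rewrite E0 => -[].
have cfs v : fs (s1 v) = fs (s0 v) by have := C v; rewrite E0 => -[].
have cR v : inR (s1 v) = inR (s0 v) by have := C v; rewrite E0 => -[].
have cA v : inA (s1 v) = inA (s0 v) by have := C v; rewrite E0 => -[].
have cm v : msg (s1 v) = msg (s0 v) by have := C v; rewrite E0 => -[].
have rcE u v : rec e s1 u v -> [/\ inR (s0 u), inA (s0 v) & e u v].
  by rewrite /rec cR cA => /and4P[].
exists (rec e s1); split=> //.
- move=> u u' v /and4P[Ru Av uv]; case Ea: (asg _) => [k|] // ku.
  case/and4P=> [Ru' _ uv']; rewrite Ea => ku'.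
  have [_ /eqP/cards1P[x Ex]] := H1 _ _ Ea.
  have: u \in [set x] by rewrite -Ex inE e_sym uv Ru.
  have: u' \in [set x] by rewrite -Ex inE e_sym uv' Ru'.
  by rewrite !inE => /eqP -> /eqP ->.
- by move=> u; rewrite E2 /= cR.
- move=> v; rewrite E2 /= cA; case Av: (inA _) => //=.
  have Rv : ~~ tx v by rewrite /tx cR (negbTE (D _ Av)).
  rewrite -[LHS]negbK -lt0n; congr (~~ _).
  apply/(nbeep_gt0 e Rv)/existsP => [[u uv]|[u /and3P[uv h1 h2]]].
    by rewrite /tx cR => /andP[h1 h2]; exists u; apply/and3P.
  by exists u; rewrite // /tx cR h1.
- by move=> v; rewrite E2 /=.
- by move=> v; rewrite E2 /= /tx cR crk cl andbA.
- by move=> v; rewrite E2 /= /tx cR crk cl cfs andbA.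
- move=> u v k Ru uv; rewrite !E2 /= => Ea ku.
  by rewrite /rec cR Ru uv Ea ku H0 ?Ea.
- move=> u v /and4P[Ru Av uv]; rewrite !E2 /=; case Ea: (asg _) => [k|] // ku.
  by exists k; split=> //; have [] := H1 _ _ Ea.
- move=> v; rewrite E2 /= => Ea; split; first by rewrite -cA; apply: H0.
  case Ek: (asg (s1 v)) Ea => [k|] // _.
  have [_ /eqP/cards1P[x Ex]] := H1 _ _ Ek.
  have := set11 x; rewrite -Ex inE e_sym => /and3P[h1 h2 h3].
  by exists x; rewrite /rec h1 h2 Ek h3 H0 ?Ek.
Qed.

Section Assigned.
Variable lam : nat.
Hypotheses (LaE : La = lam.+1) (Vlam : #|V| <= 2 ^ lam) (lamnb : lam <= nb).

Definition covered (s0 : cfg) v := inA (s0 v) && [exists u, e v u && inR (s0 u)].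

(** [PostProm] holds for all coins and costs nothing; the other conjunct is a union bound over the
    covered blue nodes. *)
Lemma assign_fail s0 : disj s0 ->
  (fail e assign (fun s2 => (exists rc, PostProm s0 s2 rc) /\
     forall v, covered s0 v -> asg (s2 v) != None) s0 <= #|V|%:R * dr ^+ q)%R.
Proof.
move=> D; apply: le_trans (fail_and _ _ _ _ _) _.
rewrite -[X in (_ <= X)%R]add0r; apply: lerD; first exact/fail_alw/assign_post.
apply: le_trans (_ : Ex e assign (fun s => \sum_(v | covered s0 v) (asg (s v) == None)%:R)%R s0 <= _)%R.
  apply: Ex_mono => s; case: asboolP => /= [_|H]; first by apply: sumr_ge0.
  rewrite -natr_sum ler_nat lt0n; apply/eqP => H'; apply: H => v cv.
  by move/eqP: H'; rewrite sum_nat_eq0 => /forallP/(_ v)/implyP/(_ cv); rewrite eqb0.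
rewrite Ex_sum; apply: le_trans (_ : \sum_(v | covered s0 v) dr ^+ q <= _)%R; last first.
  rewrite sumr_const -[X in (X <= _)%R]mulr_natl ler_wpM2r ?dr_exp_ge0 // ler_nat.
  exact: max_card.
apply: ler_sum => v /andP[Av /existsP[u /andP[uv Ru]]].
rewrite /assign -cat1s catA Ex_cat Ex_cat.
apply: Ex_le_const => w0 /=; set s0' := gstep _ _ _ _.
have E0 x : s0' x = setp (s0 x) (rk (s0 x)) (fs (s0 x)) (inR (s0 x)) (inA (s0 x)) [::] None 0 false.
  by rewrite /s0' gstep_beep.
clearbody s0'.
apply: le_trans (_ : Ex e (ops B nb La q) (fun s => (asg (s v) == None)%:R)%R s0' <= _)%R.
  by apply: Ex_mono => s; rewrite avg_const ?coin_gt0.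
apply: (ops_unassigned q LaE Vlam lamnb) => [x||]; rewrite ?E0 //; first exact: D.
by exists u => //; rewrite E0.
Qed.
End Assigned.
End Epoch.

(** * Thinning out the red nodes *)

Section Replies.
Variables (B nb La q : nat) (rr : nat -> nat).
Variables (V : finType) (e : rel V).
Hypothesis e_sym : symmetric e.
Notation node := (node B).
Notation cfg := (V -> node).
Notation assign := (assign B nb La q rr).
Notation replies := (replies B nb La q).
Notation halve := (i_halve B nb).

(** The recruiter of [v] may leave without harm: [v] has retired, or one of its red neighbours won
    the toss and therefore stays. *)
Definition okb (s2 : cfg) (w : cointype nb V) v :=
  ~~ inA (s2 v) || [exists u, [&& e v u, inR (s2 u) & ~~ low 1 (w u)]].

Definition keep (s2 : cfg) (rc : rel V) (w : cointype nb V) u :=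
  inR (s2 u) && ~~ (low 1 (w u) && [exists v, rc u v && okb s2 w v]).

Definition core' (s : node) := (lay s, rk s, fs s, inA s, msg s).

(** Induction over the replies: after the first [k] of them, the red nodes gone are the losers with
    a recruit satisfying [okb] whose operation number is below [k]. *)
Lemma replies_post s0 s2 rc w : disj s0 -> PostProm La q rr e s0 s2 rc ->
  alw e replies (fun s4 => forall u,
    core' (s4 u) = core' (s2 u) /\ inR (s4 u) = keep s2 rc w u)
  (gstep e halve s2 w).
Proof.
move=> D PP; set s3 := gstep _ _ _ _.
pose tx u := inR (s2 u) && ~~ low 1 (w u).
have E3 v : s3 v = let s := s2 v in
   setp s (rk s) (fs s) (inR s) (inA s) (smp s) (asg s) (cnt s)
     (if inR s then low 1 (w v) else 0 < nbeep e tx v).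
  by rewrite /s3 gstep_beep.
clearbody s3.
have nA u : inR (s2 u) -> asg (s2 u) = None.
  rewrite (pp_inR PP) => /andP[Ru _]; case E: (asg _) => [k|] //.
  have [|Au _] := pp_asg PP (v := u); first by rewrite E.
  by have := D _ Au; rewrite Ru.
pose before k v := if asg (s2 v) is Some a then a < k else false.
pose P k (s : cfg) := forall u, [/\ core' (s u) = core' (s2 u),
  (smp (s u), asg (s u), flg (s u)) = (smp (s3 u), asg (s3 u), flg (s3 u)) &
  inR (s u) = inR (s2 u) && ~~ (low 1 (w u) &&
     [exists v, [&& rc u v, before k v & okb s2 w v]])].
have okE u v : rc u v -> flg (s3 v) || ~~ inA (s2 v) = okb s2 w v.
  move=> /(pp_rc PP)[_ Av _].
  have Rv : inR (s2 v) = false by rewrite (pp_inR PP) (negbTE (D _ Av)).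
  rewrite E3 /= Rv /okb orbC; congr orb.
  have Tv : ~~ tx v by rewrite /tx Rv.
  apply/(nbeep_gt0 e Tv)/existsP => [[x vx /andP[h1 h2]]|[x /and3P[h1 h2 h3]]].
    by exists x; apply/and3P.
  by exists x; rewrite // /tx h2.
have : P 0 s3.
  move=> u; rewrite E3 /=; split=> //.
  rewrite [X in _ && ~~ (_ && X)](_ : _ = false) ?andbF ?andbT //.
  apply/existsP => -[v /and3P[_]]; rewrite /before.
  by case: (asg _).
move=> P0; have := alw_iota (body := fun k => [:: i_reply B nb k]) (Inv := P)
   (e := e) (a := 0) (n := La * q) _ P0.
rewrite add0n => A; apply: alw_imp (A _) => [s4 H4 u|].
  have [c4 _ r4] := H4 u; split=> //; rewrite r4 /keep; congr (_ && ~~ (_ && _)).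
  apply: eq_existsb => v; case Hrc: (rc u v) => //=.
  by have [k [Ek kT _]] := pp_idx PP Hrc; rewrite /before Ek kT.
move=> k s _ Hs w'.
suff: P k.+1 (gstep e (i_reply B nb k) s w') by [].
move=> u; rewrite gstep_beep.
have [cu [su au fu] ru] := Hs u.
split=> //=.
  by rewrite /= su au fu.
set n := nbeep _ _ _; rewrite ru.
case R2: (inR (s2 u)) => //=.
have -> : flg (s u) = low 1 (w u) by rewrite fu E3 /= R2.
case: (low 1 (w u)) => //=; rewrite -negb_or; congr (~~ _).
rewrite su E3 /=.
have R0 : inR (s0 u) by move: R2; rewrite (pp_inR PP) => /andP[].
have txE v : (asg (s v) == Some k) && (flg (s v) || ~~ inA (s v)) =
  (asg (s2 v) == Some k) && (flg (s3 v) || ~~ inA (s2 v)).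
  have [[_ _ _ cv _] [_ av fv] _] := Hs v.
  by rewrite av fv cv E3.
have Tu : ~~ ((asg (s u) == Some k) && (flg (s u) || ~~ inA (s u))).
  by rewrite txE nA.
apply/idP/existsP => [|[v /and3P[Hrc Bv Ov]]].
  case/orP => [/existsP[v /and3P[h1 h2 h3]]|].
    exists v; rewrite h1 h3 andbT /=; move: h2; rewrite /before.
    by case: (asg _) => // a; lia.
  case/andP => ku /(nbeep_gt0 e Tu)[v uv]; rewrite txE => /andP[/eqP Ea Ov].
  have Hrc : rc u v by apply: (pp_smp PP R0 uv Ea ku).
  by exists v; rewrite Hrc /before Ea ltnSn -(okE u).
have [a [Ea aT au']] := pp_idx PP Hrc.
move: Bv; rewrite /before Ea ltnS leq_eqVlt => /orP[/eqP ak|ak].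
  apply/orP; right; rewrite -ak au' /=; apply/(nbeep_gt0 e Tu); exists v.
    by have [] := pp_rc PP Hrc.
  by rewrite txE Ea ak eqxx /= (okE u).
by apply/orP; left; apply/existsP; exists v; rewrite Hrc Ea ak.
Qed.

(** A red node without a private blue node, that is, without an active blue neighbour whose only red
    neighbour it is. The number [phi] of such nodes is the potential of the thinning. *)
Definition nonl (R A : pred V) u :=
  R u && ~~ [exists v, [&& A v, e u v & [forall u', R u' && e v u' ==> (u' == u)]]].

Definition phi (s : cfg) : nat :=
  #|[set u | nonl (fun u => inR (s u)) (fun v => inA (s v)) u]|.

(** A red node that has a private blue node and stays keeps it. Otherwise let [v] be the only
    recruit of [u]. If [v] has retired, [u] leaves with probability at least 1/2; if [v] has another
    red neighbour left, [u] leaves with probability at least 1/4, when it loses and that one wins;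
    if it has none, [v] is now private to [u]. *)
Lemma nonl_avg s0 s2 rc u : 0 < nb -> disj s0 -> PostProm La q rr e s0 s2 rc ->
  (avg (fun w : cointype nb V =>
     (nonl (keep s2 rc w) (fun v => inA (s2 v)) u)%:R)
   <= hr * (nonl (fun u => inR (s0 u)) (fun v => inA (s0 v)) u)%:R)%R.
Proof.
move=> nb0 D PP.
have k2 w x : keep s2 rc w x -> inR (s2 x) by case/andP.
have [N0|N0] := boolP (nonl _ _ u); last first.
  apply: avg_le_const => [|w]; first exact: coin_gt0.
  rewrite mulr0 lern0 eqb0; apply: contra N0 => /andP[Ku Nu].
  have := k2 _ _ Ku; rewrite (pp_inR PP) => /andP[Ru nu1].
  rewrite /nonl Ru; apply: contra Nu => /existsP[v /and3P[Av uv /forallP L]].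
  apply/existsP; exists v; rewrite uv (pp_inA PP) Av /=; apply/andP; split.
    apply/existsP => -[x /and3P[vx Rx nx]].
    by have := L x; rewrite Rx vx => /eqP xu; move: nx; rewrite xu (eqP nu1).
  apply/forallP => x; apply/implyP => /andP[/k2]; rewrite (pp_inR PP) => /andP[Rx _] vx.
  by have := L x; rewrite Rx vx.
rewrite mulr1.
have W0 := coin_gt0 nb V.
case R2: (inR (s2 u)); last first.
  apply: avg_le_const => // w; rewrite /nonl /keep R2 /=; exact: hr_ge0.
move: (R2); rewrite (pp_inR PP) => /andP[R0 /cards1P[v Ev]].
have Hrc : rc u v by have := set11 v; rewrite -Ev inE.
have [_ Av uv] := pp_rc PP Hrc.
have bnd (f : cointype nb V -> bool) (c : rat) :
    (avg (fun w => (f w)%:R) = c)%R -> (forall w, f w -> ~~ nonl (keep s2 rc w) (fun v => inA (s2 v)) u) ->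
    (avg (fun w : cointype nb V => (nonl (keep s2 rc w) (fun v => inA (s2 v)) u)%:R) <= 1 - c)%R.
  move=> Ec H; rewrite lerBrDr -Ec -avgD -[X in (_ <= X)%R](avg_const W0).
  apply: avg_le => // w; have := H w; case: (f w) => [/(_ isT)|_].
    by move=> /negbTE ->; rewrite add0r.
  by rewrite addr0 lern1 leq_b1.
have Kf (w : cointype nb V) : low 1 (w u) -> okb s2 w v ->
    ~~ nonl (keep s2 rc w) (fun v => inA (s2 v)) u.
  move=> lw ok; rewrite /nonl /keep lw (_ : [exists _, _] = true) ?andbF //.
  by apply/existsP; exists v; rewrite Hrc.
case A2: (inA (s2 v)); last first.
  apply: le_trans (bnd _ _ (avg_half u nb0) _) _; last by rewrite /hr; lra.
  by move=> w lw; apply: Kf; rewrite // /okb A2.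
have [/existsP[u' /and3P[vu' R2' uu']]|/existsPn L] :=
  boolP [exists u', [&& e v u', inR (s2 u') & u' != u]].
  rewrite eq_sym in uu'.
  apply: le_trans (bnd _ _ (avg_halve nb0 uu') _) _; last by rewrite /hr; lra.
  move=> w /andP[lw lw']; apply: Kf => //; rewrite /okb A2 /=.
  by apply/existsP; exists u'; rewrite vu' R2'.
apply: avg_le_const => // w.
rewrite (_ : nonl _ _ u = false) ?hr_ge0 //; apply/negP => /andP[_ /existsPn/(_ v)].
rewrite A2 uv /= => /forallPn[x]; rewrite negb_imply => /andP[/andP[/k2 Rx vx] xu].
by have := L x; rewrite vx Rx xu.
Qed.

Lemma phi_halve s0 s2 rc : 0 < nb -> disj s0 -> PostProm La q rr e s0 s2 rc ->
  (Ex e (halve :: replies) (fun s => (phi s)%:R) s2 <= hr * (phi s0)%:R)%R.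
Proof.
move=> nb0 D PP.
have W0 := coin_gt0 nb V.
apply: le_trans (_ : avg (fun w : cointype nb V =>
   \sum_u (nonl (keep s2 rc w) (fun v => inA (s2 v)) u)%:R)%R <= _)%R.
  apply: avg_le => // w; apply: Ex_le_const.
  apply: alw_imp (replies_post w D PP) => s4 H4.
  rewrite -natr_sum ler_nat /phi cardsE -sum1_card big_mkcond /=.
  apply: leq_sum => u _; rewrite [u \in _](_ : _ = nonl (keep s2 rc w) (fun v => inA (s2 v)) u).
    by case: nonl.
  transitivity (nonl (fun u => inR (s4 u)) (fun v => inA (s4 v)) u) => //.
  have R4 x : inR (s4 x) = keep s2 rc w x by have [] := H4 x.
  have A4 x : inA (s4 x) = inA (s2 x) by have [[]] := H4 x.
  rewrite /nonl R4; congr (_ && ~~ _); apply: eq_existsb => v.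
  by rewrite A4; congr [&& _, _ & _]; apply: eq_forallb => x; rewrite R4.
rewrite avg_sum /phi cardsE -sum1_card natr_sum mulr_sumr [X in (_ <= X)%R]big_mkcond /=.
apply: ler_sum => u _; apply: le_trans (nonl_avg u nb0 D PP) _.
rewrite [u \in _](_ : _ = nonl (fun u => inR (s0 u)) (fun v => inA (s0 v)) u) //.
by case: (nonl _ _ u); rewrite ?mulr1 ?mulr0.
Qed.

End Replies.

(** * Invariants of the ranking of a layer, and its failure probability *)

Lemma charge (V : finType) (rc : rel V) (P D : pred V) (F G : V -> nat) :
  (forall u u' v, rc u v -> rc u' v -> u = u') ->
  (forall u, P u -> G u <= \sum_(v | rc u v) F v) ->
  (forall u v, P u -> rc u v -> D v) ->
  \sum_(u | P u) G u <= \sum_(v | D v) F v.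
Proof.
move=> U H1 H2.
apply: leq_trans (_ : \sum_(u | P u) \sum_(v | rc u v) F v <= _).
  exact: leq_sum.
rewrite (exchange_big_dep D H2) /=.
apply: leq_sum => v _.
have [/existsP[u /andP[Pu ru]]|/existsPn N] := boolP [exists u, P u && rc u v].
  rewrite (bigD1 u) ?Pu //= big1 ?addn0 // => u' /andP[/andP[_ ru'] /eqP uu'].
  by case: uu'; apply: U ru' ru.
by rewrite big1 // => u Pu; have := N u; rewrite Pu.
Qed.

Section Process.
Variables (B nb La q : nat) (red : nat -> bool) (rr : nat -> nat) (blue : nat -> nat -> bool).
Variables (V : finType) (e : rel V).
Hypothesis e_sym : symmetric e.
Notation node := (node B).
Notation cfg := (V -> node).
Notation assign := (assign B nb La q rr).
Notation replies := (replies B nb La q).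
Notation halve := (i_halve B nb).
Notation epoch := (epoch B nb La q rr).
Notation proc := (proc B nb La q red rr blue).

Variable sI : cfg.
Definition rd u := red (lay (sI u)).
Definition bl v := blue (lay (sI v)) (rk (sI v)).
Definition rI u := rr (lay (sI u)).

Hypothesis rb_disj : forall v, bl v -> ~~ rd v.
Hypothesis rb_adj : forall u v, rd u -> bl v -> e u v ->
  lay (sI v) = (lay (sI u)).+1 /\ rk (sI v) = rI u.

(** The potential that will bound the ranks: the weight 2^(r+1) of a promoted node is paid by its
    recruits, at least two, of weight 2^r each. Layers, and the ranks of blue nodes, are read off at
    the start [sI]. *)
Definition wt l (s : cfg) := \sum_(u | lay (sI u) == l) 2 ^ rk (s u).
Definition wtA l (A : pred V) := \sum_(v | (lay (sI v) == l.+1) && A v) 2 ^ rk (sI v).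

(** In [pi_wt] the weight of the blue nodes still active is unspent budget; only retired ones have
    paid for a promotion. *)
Record PI (s : cfg) : Prop := {
  pi_same : forall v, lay (s v) = lay (sI v) /\ msg (s v) = msg (sI v);
  pi_R : forall v, inR (s v) -> rd v;
  pi_A : forall v, inA (s v) -> bl v;
  pi_rk : forall u, (rk (s u), fs (s u)) = (rk (sI u), fs (sI u)) \/
    [/\ rd u, rk (sI u) <= rI u, rk (s u) = (rI u).+1, fs (s u) = false & ~~ inR (s u)];
  pi_bl : forall v, bl v -> inA (s v) \/
    exists u, [/\ rd u, e v u & rk (sI v) < rk (s u)];
  pi_wt : forall l, wt l s + wtA l (fun v => inA (s v)) <= wt l sI + wtA l bl
}.

Lemma PI_disj s : PI s -> disj s.
Proof. by move=> H v /(pi_A H)/rb_disj; apply: contra => /(pi_R H). Qed.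

Lemma rc_weight s0 s2 rc u : PI s0 -> PostProm La q rr e s0 s2 rc ->
  \sum_(v | rc u v) 2 ^ rk (sI v) = nrc rc u * 2 ^ rI u.
Proof.
move=> H PP; rewrite (eq_bigr (fun=> 2 ^ rI u)) => [|v Hrc].
  by rewrite sum_nat_const /nrc cardsE.
have [Ru Av uv] := pp_rc PP Hrc.
by have [_ ->] := rb_adj (pi_R H Ru) (pi_A H Av) uv.
Qed.

Lemma PI_prom s0 s2 rc : PI s0 -> PostProm La q rr e s0 s2 rc -> PI s2.
Proof.
move=> H PP; split.
- by move=> v; have [-> ->] := pp_same PP v; apply: pi_same H v.
- by move=> v; rewrite (pp_inR PP) => /andP[/(pi_R H)].
- by move=> v; rewrite (pp_inA PP) => /andP[/(pi_A H)].
- move=> u; rewrite (pp_rk PP) (pp_fs PP) (pp_inR PP).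
  have [Eu _] := pi_same H u; rewrite Eu -/(rI u).
  case: ifP => [/and3P[Ru n1 ri]|_] /=; last first.
    rewrite andbT; have [E|[h1 h2 h3 h4 /negbTE h5]] := pi_rk H u; first by left.
    by right; rewrite h5.
  right; have [[E _]|[_ _ _ _ /negP[]]] := pi_rk H u; last by [].
  rewrite -E ri andbF Ru /=; split=> //; first exact: pi_R H _ Ru.
  by apply/eqP => E1; rewrite E1 in n1.
- move=> v bv; rewrite (pp_inA PP).
  have rkmono u : rk (s0 u) <= rk (s2 u).
    by rewrite (pp_rk PP); case: ifP => // /and3P[_ _]; lia.
  have [Av|[u [h1 h2 h3]]] := pi_bl H bv; last first.
    by right; exists u; split=> //; apply: leq_trans h3 _.
  rewrite Av /=; case: existsP => [[u /and3P[vu Ru nu]]|]; last by left.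
  right; exists u; split=> //; first exact: pi_R H _ Ru.
  rewrite e_sym in vu; have [_ ->] := rb_adj (pi_R H Ru) bv vu.
  rewrite (pp_rk PP) Ru nu /=; have [-> _] := pi_same H u.
  by rewrite -/(rI u); have [] := leqP (rk (s0 u)) (rI u).
move=> l; apply: leq_trans (pi_wt H l).
pose P u := [&& lay (sI u) == l, inR (s0 u) & 1 < nrc rc u].
pose D v := (lay (sI v) == l.+1) && (inA (s0 v) && ~~ inA (s2 v)).
(* All recruits of a red node with two or more of them retire, and the weight they release covers
   its new rank. *)
have C : \sum_(u | P u) 2 ^ (rI u).+1 <= \sum_(v | D v) 2 ^ rk (sI v).
  apply: (charge (rc := rc)) => [||u v /and3P[/eqP lu Ru nu] Hrc].
  - exact: pp_uniq PP.
  - move=> u /and3P[_ _ nu]; rewrite (rc_weight u H PP) expnS leq_mul2r.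
    by rewrite nu orbT.
  have [_ Av uv] := pp_rc PP Hrc.
  have [lv _] := rb_adj (pi_R H Ru) (pi_A H Av) uv.
  rewrite /D lv lu eqxx Av (pp_inA PP) Av /= negbK.
  by apply/existsP; exists u; rewrite e_sym uv Ru.
have E1 : wt l s2 <= wt l s0 + \sum_(u | P u) 2 ^ (rI u).+1.
  rewrite /wt [X in _ + X](_ : _ = \sum_(u | lay (sI u) == l) if P u then 2 ^ (rI u).+1 else 0).
    rewrite -big_split /=; apply: leq_sum => u lu; rewrite (pp_rk PP) /P lu /=.
    have [-> _] := pi_same H u; rewrite -/(rI u).
    by case: (inR _); case: (1 < _); rewrite /= ?addn0 //; case: ifP; rewrite ?leq_addl ?leq_addr.
  rewrite big_mkcond [RHS]big_mkcond; apply: eq_bigr => u _.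
  by rewrite /P; case: eqP.
have E2 : wtA l (fun v => inA (s0 v)) =
   wtA l (fun v => inA (s2 v)) + \sum_(v | D v) 2 ^ rk (sI v).
  rewrite /wtA (bigID (fun v => inA (s2 v))) /=; congr (_ + _); apply: eq_bigl => v.
    by rewrite (pp_inA PP); case: (_ == _) => //=; case: (inA _).
  by rewrite /D andbA.
lia.
Qed.

Lemma PI_sub s2 s4 : PI s2 ->
  (forall u, core' (s4 u) = core' (s2 u)) -> (forall u, inR (s4 u) -> inR (s2 u)) -> PI s4.
Proof.
move=> H C R.
have cl v : lay (s4 v) = lay (s2 v) by have := C v => -[].
have crk v : rk (s4 v) = rk (s2 v) by have := C v => -[].
have cfs v : fs (s4 v) = fs (s2 v) by have := C v => -[].
have cA v : inA (s4 v) = inA (s2 v) by have := C v => -[].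
have cm v : msg (s4 v) = msg (s2 v) by have := C v => -[].
split.
- by move=> v; rewrite cl cm; apply: pi_same H v.
- by move=> v /R/(pi_R H).
- by move=> v; rewrite cA => /(pi_A H).
- move=> u; rewrite crk cfs; have [|[h1 h2 h3 h4 h5]] := pi_rk H u; first by left.
  by right; split=> //; apply: contra h5 => /R.
- move=> v /(pi_bl H)[h|[u [h1 h2 h3]]]; first by left; rewrite cA.
  by right; exists u; rewrite crk.
move=> l; apply: leq_trans (pi_wt H l); apply: leq_add.
  by apply: leq_sum => u _; rewrite crk.
by rewrite leq_eqVlt; apply/orP; left; apply/eqP/eq_bigl => v; rewrite cA.
Qed.

Lemma PI_epoch s : PI s -> alw e epoch PI s.
Proof.
move=> H; apply/alw_cat.
have A := @assign_post B nb La q rr V e e_sym _ (PI_disj H).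
apply: alw_imp A => s2 [rc PP] w.
apply: alw_imp (replies_post w (PI_disj H) PP) => s4 H4.
apply: (PI_sub (PI_prom H PP)) => u; first by have [] := H4 u.
by have [_ ->] := H4 u; case/andP.
Qed.

Definition cov (s : cfg) := forall v, inA (s v) -> exists2 u, e v u & inR (s u).

Lemma phi_epoch s : 0 < nb -> PI s ->
  (Ex e epoch (fun s' => (phi e s')%:R) s <= hr * (phi e s)%:R)%R.
Proof.
move=> nb0 H; rewrite /epoch Ex_cat; apply: Ex_le_const.
have A := @assign_post B nb La q rr V e e_sym _ (PI_disj H).
apply: alw_imp A => s2 [rc PP].
exact: phi_halve (PI_disj H) PP.
Qed.

Section Fail.
Variable lam : nat.
Hypotheses (nb0 : 0 < nb) (LaE : La = lam.+1) (Vlam : #|V| <= 2 ^ lam) (lamnb : lam <= nb).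

Definition eps : rat := (#|V|%:R * dr ^+ q)%R.

Lemma eps_ge0 : (0 <= eps)%R.
Proof. by rewrite mulr_ge0 ?dr_exp_ge0. Qed.

Lemma assign_cov s : PI s -> cov s ->
  (fail e assign (fun s2 => exists rc, PostProm La q rr e s s2 rc /\
     forall v, inA (s v) -> exists u, rc u v) s <= eps)%R.
Proof.
move=> H C; apply: le_trans (assign_fail q rr e_sym LaE Vlam lamnb (PI_disj H)).
apply: fail_imp; apply: alw_true => s2 [[rc PP] A]; exists rc; split=> // v Av.
have [u vu Ru] := C v Av.
have /(pp_asg PP)[] // : asg (s2 v) != None.
by apply: A; rewrite /covered Av; apply/existsP; exists u; rewrite vu.
Qed.

(** An active [v] is the only recruit of its recruiter [u], since otherwise [v] would have retired.
    If [u] leaves, it is because [v] has a red neighbour that won the toss, and this one stays and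
    covers [v]. *)
Lemma cov_epoch s : PI s -> cov s -> (fail e epoch cov s <= eps)%R.
Proof.
move=> H C; rewrite -[eps]addr0.
apply: (fail_cat _ (assign_cov H C)) => // s2 [rc [PP A]].
apply: fail_alw => w; apply: alw_imp (replies_post w (PI_disj H) PP) => s4 H4 v.
have [[_ _ _ -> _] _] := H4 v => A2.
have A0 : inA (s v) by move: A2; rewrite (pp_inA PP) => /andP[].
have [u Hrc] := A v A0.
have [Ru _ uv] := pp_rc PP Hrc.
have n1 : nrc rc u = 1.
  apply/eqP; rewrite eqn_leq card_gt0; apply/andP; split; last by apply/set0Pn; exists v; rewrite inE.
  rewrite leqNgt; apply/negP => n2.
  move: A2; rewrite (pp_inA PP) => /andP[_ /existsP[]]; exists u.
  by rewrite e_sym uv Ru.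
have R2 : inR (s2 u) by rewrite (pp_inR PP) Ru n1.
have [K|] := boolP (keep e s2 rc w u).
  by exists u; [rewrite e_sym|have [_ ->] := H4 u].
rewrite /keep R2 /= negbK => /andP[lw /existsP[v' /andP[Hrc' ok]]].
have Ev : v' = v.
  have /eqP/cards1P[x Ex] : nrc rc u = 1 by [].
  have : v \in [set x] by rewrite -Ex inE.
  have : v' \in [set x] by rewrite -Ex inE.
  by rewrite !inE => /eqP -> /eqP ->.
move: ok; rewrite /okb Ev A2 /= => /existsP[u' /and3P[vu' R2' lw']].
exists u' => //; have [_ ->] := H4 u'.
by rewrite /keep R2' (negbTE lw').
Qed.

(** Markov's inequality: [phi] is a natural number whose mean shrinks by the factor [hr] per epoch,
    so its mean bounds the probability that it is nonzero. *)
Lemma epochs_fail K s : PI s -> cov s ->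
  (fail e (flatten (nseq K epoch)) (fun s' => [/\ PI s', cov s' & phi e s' = 0%N]) s
   <= K%:R * eps + hr ^+ K * (phi e s)%:R)%R.
Proof.
elim: K s => [|K IH] s H C.
  rewrite mul0r add0r expr0 mul1r /fail /=.
  case: asboolP => [_|N]; first exact: ler0n.
  by rewrite ler_nat lt0n; apply/eqP => E; apply: N.
rewrite [flatten _](_ : _ = epoch ++ flatten (nseq K epoch)) // /fail Ex_cat.
apply: le_trans (_ : Ex e epoch (fun s' => (~~ `[< cov s' >])%:R +
    (K%:R * eps + hr ^+ K * (phi e s')%:R))%R s <= _)%R.
  apply: Ex_le; apply: alw_imp (PI_epoch H) => s' H'.
  case: asboolP => C' /=; first by rewrite add0r; apply: IH.
  apply: le_trans (fail_le1 _ _ _ _) _; rewrite lerDl addr_ge0 //.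
    by rewrite mulr_ge0 ?eps_ge0.
  by rewrite mulr_ge0 ?hr_exp_ge0.
rewrite ExD ExD Ex_const ExZ -(natr1 K) [((K%:R + 1) * eps)%R]mulrDl mul1r.
rewrite [X in (_ <= X + _)%R]addrC -addrA.
apply: lerD; first exact: cov_epoch.
rewrite lerD2l exprSr -mulrA; apply: ler_wpM2l; first exact: hr_exp_ge0.
exact: phi_epoch.
Qed.

Definition served (s : cfg) v :=
  (exists u, [/\ rd u, e v u & rk (sI v) < rk (s u)]) \/
  #|[set u | [&& e v u, rd u, rk (s u) == rk (sI v) & fs (s u)]]| = 1.

Record Post (s : cfg) : Prop := {
  po_same : forall v, lay (s v) = lay (sI v) /\ msg (s v) = msg (sI v);
  po_rk : forall u, (rk (s u), fs (s u)) = (rk (sI u), fs (sI u)) \/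
    [/\ rd u, rk (sI u) <= rI u &
       (rk (s u) = (rI u).+1 /\ fs (s u) = false) \/ (rk (s u) = rI u /\ fs (s u))];
  po_good : forall v, bl v -> served s v;
  po_wt : forall l, wt l s <= wt l sI + wtA l bl
}.

(** A layer handles larger ranks in earlier steps, so a red node is either untouched or has a rank
    above the current one. *)
Hypothesis pre : forall u, rd u -> (rk (sI u) = 0 /\ ~~ fs (sI u)) \/ rI u < rk (sI u).

Lemma final_fail s : PI s -> cov s -> phi e s = 0 ->
  (fail e (assign ++ [:: i_fin B nb rr]) Post s <= eps)%R.
Proof.
move=> H C F; rewrite -[eps]addr0.
apply: (fail_cat _ (assign_cov H C)) => // s2 [rc [PP A]].
have H2 := PI_prom H PP.
apply: fail_alw => w; set s5 := gstep _ _ _ _.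
have E5 u : s5 u = let s := s2 u in let p := inR s && (rk s <= rI u) in
  setp s (if p then rI u else rk s) (fs s || p) (inR s) false (smp s) (asg s) (cnt s) (flg s).
  rewrite /s5 gstep_beep /=; have [-> _] := pi_same H2 u.
  by [].
clearbody s5.
have single u v v' : inR (s2 u) -> rc u v -> rc u v' -> v' = v.
  rewrite (pp_inR PP) => /andP[_ /cards1P[x Ex]] h h'.
  have : v \in [set x] by rewrite -Ex inE.
  have : v' \in [set x] by rewrite -Ex inE.
  by rewrite !inE => /eqP -> /eqP ->.
(* As [phi] is 0, [u] has a private blue node. Its recruiter can only be [u], so it is the single
   recruit [v] of [u]. *)
have lone u v : inR (s2 u) -> rc u v -> forall x, inR (s x) -> e v x -> x = u.
  move=> R2 Hrc.
  have Ru : inR (s u) by move: R2; rewrite (pp_inR PP) => /andP[].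
  have : u \notin [set u | nonl e (fun u => inR (s u)) (fun v => inA (s v)) u].
    by rewrite (cards0_eq F) inE.
  rewrite inE /nonl Ru /= negbK => /existsP[v' /and3P[Av' uv' /forallP L]].
  have [u'' Hrc''] := A v' Av'.
  have [R'' _ e''] := pp_rc PP Hrc''.
  have Eu : u'' = u by have := L u''; rewrite R'' e_sym e'' => /eqP.
  rewrite Eu in Hrc''; rewrite -(single _ _ _ R2 Hrc Hrc'') => x Rx vx.
  by have := L x; rewrite Rx vx => /eqP.
(* The only red neighbour of [v] was not promoted, so [v] did not retire. *)
have A2 u v : inR (s2 u) -> rc u v -> inA (s2 v).
  move=> R2 Hrc; have [_ Av _] := pp_rc PP Hrc; rewrite (pp_inA PP) Av /=.
  apply/existsP => -[x /and3P[vx Rx nx]].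
  have xu := lone _ _ R2 Hrc _ Rx vx; move: R2; rewrite -xu (pp_inR PP) => /andP[_ /eqP E].
  by rewrite E in nx.
split.
- by move=> v; rewrite E5 /=; apply: pi_same H2 v.
- move=> u; rewrite E5 /=; have [E|[h1 h2 h3 h4 h5]] := pi_rk H2 u; last first.
    by right; split=> //; left; rewrite (negbTE h5) /= orbF.
  case: ifP => [/andP[R2 ru]|_]; last by left; rewrite orbF.
  right; case: E => <- _; split=> //; first exact: pi_R H2 _ R2.
  by right; rewrite orbT.
- move=> v bv.
  have far u : rd u -> e v u -> rk (sI v) < rk (s2 u) -> served s5 v.
    move=> du vu h3; left; exists u; split=> //; rewrite E5 /=; case: ifP => // /andP[_ ru].
    by rewrite e_sym in vu; have [_ E] := rb_adj du bv vu; lia.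
  have [Av|[u [h1 h2 h3]]] := pi_bl H2 bv; last exact: far h3.
  have A0 : inA (s v) by move: Av; rewrite (pp_inA PP) => /andP[].
  have [u Hrc] := A v A0.
  have [Ru _ uv] := pp_rc PP Hrc.
  have vu : e v u by rewrite e_sym.
  have du := pi_R H Ru.
  have n1 : nrc rc u = 1.
    apply/eqP; rewrite eqn_leq card_gt0; apply/andP; split; last by apply/set0Pn; exists v; rewrite inE.
    rewrite leqNgt; apply/negP => n2.
    move: Av; rewrite (pp_inA PP) => /andP[_ /existsP[]]; exists u.
    by rewrite vu Ru.
  have R2 : inR (s2 u) by rewrite (pp_inR PP) Ru n1.
  have [_ Er] := rb_adj du bv uv.
  have [ru|ru] := leqP (rk (s2 u)) (rI u); last by apply: (far u) => //; rewrite Er.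
  right; rewrite (_ : [set _ | _] = [set u]) ?cards1 //; apply/setP => x; rewrite !inE.
  have [->|xu] := eqVneq x u.
    by rewrite vu du E5 /= R2 ru /= orbT Er eqxx.
  apply/negP => /and4P[vx dx]; rewrite E5 /=.
  have -> : inR (s2 x) = false.
    apply/negP; rewrite (pp_inR PP) => /andP[Rx _].
    by case/eqP: xu; apply: lone R2 Hrc _ Rx vx.
  rewrite /= orbF => /eqP Erx fx.
  rewrite e_sym in vx; have [_ Er'] := rb_adj dx bv vx.
  have [[E1 E2]|[_ _ E1 E2 _]] := pi_rk H2 x; last by rewrite E2 in fx.
  (* A mark at the same rank left over from an earlier step is excluded by [pre]. *)
  have [[h1 h2]|h] := pre dx; first by rewrite -E2 fx in h2.
  by move: h; rewrite -E1 Erx Er' ltnn.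
move=> l; apply: leq_trans (pi_wt H2 l).
pose P u := [&& lay (sI u) == l, inR (s2 u) & rk (s2 u) <= rI u].
(* A node that gets rank [rI] is paid for by its single recruit, whose weight is still unspent. *)
have Cg : \sum_(u | P u) 2 ^ rI u <= wtA l (fun v => inA (s2 v)).
  apply: (charge (rc := rc)) => [||u v /and3P[/eqP lu R2 ru] Hrc].
  - exact: pp_uniq PP.
  - move=> u /and3P[_ R2 _]; rewrite (rc_weight u H PP).
    by move: R2; rewrite (pp_inR PP) => /andP[_ /eqP ->]; rewrite mul1n.
  rewrite (A2 u v) // andbT; have [Ru Av uv] := pp_rc PP Hrc.
  by have [-> _] := rb_adj (pi_R H Ru) (pi_A H Av) uv; rewrite lu.
apply: leq_trans (leq_add (leqnn _) Cg); rewrite /wt.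
rewrite [X in _ + X](_ : _ = \sum_(u | lay (sI u) == l) if P u then 2 ^ rI u else 0).
  rewrite -big_split /=; apply: leq_sum => u lu; rewrite E5 /P lu /=.
  by case: ifP; lia.
rewrite big_mkcond [RHS]big_mkcond; apply: eq_bigr => u _.
by rewrite /P; case: eqP.
Qed.

Lemma proc_fail :
  (forall v, bl v -> exists2 u, e v u & rd u) ->
  (fail e proc Post sI <= q.+1%:R * eps + hr ^+ q * #|V|%:R)%R.
Proof.
move=> cv; rewrite /proc -cat1s.
pose Q1 s := PI s /\ cov s.
rewrite -[X in (_ <= X)%R]add0r; apply: (fail_cat (Q := Q1)).
- by apply: addr_ge0; apply: mulr_ge0; rewrite ?eps_ge0 ?hr_exp_ge0 ?ler0n.
- apply: fail_alw => w; set s := gstep _ _ _ _.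
  have Es v : s v = setp (sI v) (rk (sI v)) (fs (sI v)) (rd v) (bl v) [::] None 0 false.
    by rewrite /s gstep_beep.
  clearbody s; split; last first.
    move=> v; rewrite Es /= => /cv[u vu du]; exists u => //; by rewrite Es.
  split; try by move=> v; rewrite Es.
  + by move=> u; left; rewrite Es.
  + by move=> v bv; left; rewrite Es.
  + move=> l; rewrite /wt /wtA; apply: leq_add.
      by apply: leq_sum => u _; rewrite Es.
    by rewrite leq_eqVlt; apply/orP; left; apply/eqP/eq_bigl => v; rewrite Es.
- move=> s [H C]; rewrite -(natr1 q) [((q%:R + 1) * eps)%R]mulrDl mul1r -addrA [X in (_ <= _ + X)%R]addrC addrA.
  apply: (fail_cat (Q := fun s' => [/\ PI s', cov s' & phi e s' = 0%N])).
  + exact: eps_ge0.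
  + apply: le_trans (epochs_fail q H C) _; rewrite lerD2l.
    apply: ler_wpM2l; first exact: hr_exp_ge0.
    by rewrite ler_nat max_card.
  + by move=> s' [H' C' F']; apply: final_fail.
Qed.

End Fail.
End Process.

(** * Ranking all rings in parallel *)

Section Schedule.
Variable w : nat.
Hypothesis w0 : 0 < w.

(* The red layer [l] handles rank [r] in step [key l - 3 * r]: the layers at
   work in one step agree modulo 3, hence do not interfere, and the nodes of
   rank [r] in layer [l + 1] are known by then (see [key_gap]). *)
Definition depth l := w.-1 - l %% w.
Definition key l := 6 * depth l + l %% 3.
Definition red th l := [&& 0 < depth l, th <= key l & 3 %| key l - th].
Definition rrf th l := (key l - th) %/ 3.
Definition blue th l r := (l %% w != 0) && (key l.-1 == th + 3 * r).

Lemma modn_pred l : l %% w != 0 -> l.-1 %% w = (l %% w).-1.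
Proof.
rewrite -lt0n => lw.
have -> : l.-1 = l %/ w * w + (l %% w).-1.
  by rewrite {1}(divn_eq l w) -!subn1 addnBA.
by rewrite modnMDl modn_small //; move: (ltn_pmod l w0); lia.
Qed.

Lemma depth_pred l : l %% w != 0 -> depth l.-1 = (depth l).+1.
Proof.
by move=> lw; rewrite /depth modn_pred //; move: (ltn_pmod l w0); lia.
Qed.

(** One unit of [depth] adds 6 and the residue drops by at most 1. More than 4 is needed: a rank may
    become [rrf + 1], which shifts by 3, and the step advances by 1. *)
Lemma key_gap l : l %% w != 0 -> key l + 5 <= key l.-1.
Proof.
move=> lw; rewrite /key depth_pred //.
have : l != 0 by apply: contra lw => /eqP ->; rewrite mod0n.
lia.
Qed.

Lemma key_lt l : key l < 6 * w.
Proof. rewrite /key /depth; lia. Qed.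

Lemma redP th l : red th l -> key l = th + 3 * rrf th l.
Proof. by case/and3P=> _ h1 /divnK h2; rewrite /rrf; lia. Qed.

Lemma key_mod l : key l %% 3 = l %% 3.
Proof. rewrite /key; lia. Qed.

Lemma red_mod th l : red th l -> l %% 3 = th %% 3.
Proof. move=> /redP E; rewrite -key_mod E; lia. Qed.

Lemma blueP th l r : blue th l r -> [/\ 0 < l, l %% w != 0 & key l.-1 = th + 3 * r].
Proof.
case/andP=> lw /eqP E; split=> //; rewrite lt0n.
by apply: contra lw => /eqP ->; rewrite mod0n.
Qed.

Lemma blue_mod th l r : blue th l r -> l.-1 %% 3 = th %% 3.
Proof. move=> /blueP[_ _ E]; rewrite -key_mod E; lia. Qed.

Lemma blue_red th l r : blue th l r -> red th l.-1 && (rrf th l.-1 == r).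
Proof.
move=> /blueP[_ lw E]; rewrite /red /rrf depth_pred // E addKn mulKn //.
by rewrite dvdn_mulr //= eqxx leq_addr.
Qed.

End Schedule.

(** * The invariant across all steps of the ranking *)

Section Pipeline.
Variables (B nb La q w lam : nat) (V : finType) (e : rel V) (L : V -> nat).
Hypothesis w0 : 0 < w.
Hypothesis e_sym : symmetric e.
Hypothesis L_adj : forall u v, e u v -> L v <= (L u).+1.
Hypothesis L_up : forall v, 0 < L v -> exists2 u, e v u & (L u).+1 = L v.
Hypotheses (nb0 : 0 < nb) (LaE : La = lam.+1) (Vlam : #|V| <= 2 ^ lam) (lamnb : lam <= nb).
Notation node := (node B).
Notation cfg := (V -> node).
Notation red := (red w).
Notation rrf := (rrf w).
Notation blue := (blue w).
Notation key := (key w).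
Notation proc th := (proc B nb La q (red th) (rrf th) (blue th)).

Definition pipeline := flatten [seq proc th | th <- iota 0 (6 * w)].

Variable M : V -> option message.

Definition good (st : cfg) v :=
  (exists u, [/\ e v u, (L u).+1 = L v & rk (st v) < rk (st u)]) \/
  #|[set u | [&& e v u, (L u).+1 == L v, rk (st u) == rk (st v) & fs (st u)]]| = 1.

Definition W l (st : cfg) := \sum_(u | L u == l) 2 ^ rk (st u).

(** The condition [key l < th + 3 * r] says that the step in which layer [l] handles rank [r] lies
    before [th]. In [pl_W] a layer is charged to its own size and to the nodes of the next layer of
    the ring whose rank has been handled. *)
Record Pipe th (st : cfg) : Prop := {
  pl_lay : forall v, lay (st v) = L v;
  pl_msg : forall v, msg (st v) = M v;
  pl_rk : forall u, (rk (st u) = 0 /\ ~~ fs (st u)) \/ key (L u) < th + 3 * rk (st u);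
  pl_good : forall v, L v %% w != 0 -> key (L v).-1 < th + 3 * rk (st v) -> good st v;
  pl_W : forall l, W l st <= #|[set v | L v == l]| +
    \sum_(v | [&& l.+1 %% w != 0, L v == l.+1 & key l < th + 3 * rk (st v)]) 2 ^ rk (st v)
}.

Lemma Pipe_step th st st' : Pipe th st ->
  Post (red th) (rrf th) (blue th) e st st' -> Pipe th.+1 st'.
Proof.
move=> H P.
have lE v : lay (st v) = L v by apply: pl_lay H v.
have rdE u : rd (red th) st u = red th (L u) by rewrite /rd lE.
have blE v : bl (blue th) st v = blue th (L v) (rk (st v)) by rewrite /bl lE.
have rE u : rI (rrf th) st u = rrf th (L u) by rewrite /rI lE.
have chg u : (rk (st' u), fs (st' u)) = (rk (st u), fs (st u)) \/
    [/\ key (L u) = th + 3 * rrf th (L u), rk (st u) = 0, ~~ fs (st u) &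
     (rk (st' u) = (rrf th (L u)).+1 /\ fs (st' u) = false) \/
     (rk (st' u) = rrf th (L u) /\ fs (st' u))].
  have [|[h1 h2 h3]] := po_rk P u; first by left.
  rewrite rdE in h1; rewrite rE in h2 h3; have K := redP w0 h1.
  by right; have [[r0 f0]|] := pl_rk H u; [split|lia].
have bl_same v : blue th (L v) (rk (st v)) -> rk (st' v) = rk (st v).
  move=> bv; have [[]//|[h1 _]] := po_rk P v; rewrite rdE in h1.
  move: (red_mod w0 h1) (blue_mod w0 bv); have [] := blueP bv; lia.
split.
- by move=> v; have [-> _] := po_same P v.
- by move=> v; have [_ ->] := po_same P v; apply: pl_msg H v.
- move=> u; have [[-> ->]|[K r0 f0 h]] := chg u.
    by have [|h] := pl_rk H u; [left|right; lia].
  by right; case: h => -[-> _]; lia.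
- move=> v vw kv.
  (* A node that changes in this step gets a rank that the layer above has yet to handle, by
     [key_gap]. *)
  have same : rk (st' v) = rk (st v).
    have [[]//|[K r0 f0 h]] := chg v.
    by have := key_gap w0 vw; case: h kv => -[-> _]; lia.
  have Lv0 : 0 < L v by rewrite lt0n; apply: contra vw => /eqP ->; rewrite mod0n.
  move: kv; rewrite same => kv.
  have [K|K] := ltnP (key (L v).-1) (th + 3 * rk (st v)).
    (* A node above that changes now handles a rank below that of [v]: it reaches at most the rank
       of [v], and not with a mark, so [good] is not disturbed. *)
    have stable u : (L u).+1 = L v ->
        (rk (st' u), fs (st' u)) = (rk (st u), fs (st u)) \/
        [/\ rk (st u) = 0, ~~ fs (st u), rk (st' u) <= rk (st v) &
            (rk (st' u) == rk (st v)) && fs (st' u) = false] /\ 0 < rk (st v).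
      move=> Luv; have [|[Ku r0 f0 h]] := chg u; first by left.
      move: K; rewrite -Luv /= Ku => K; right; split; last by lia.
      by split=> //; case: h => -[-> E]; rewrite ?E ?andbF ?andbT //; lia.
    have [[u [vu Lu h]]|h] := pl_good H vw K.
      left; exists u; split=> //; rewrite same.
      by have [[-> _] //|[[r0 _ _ _] _]] := stable u Lu; lia.
    right; rewrite -h; apply: eq_card => u; rewrite !inE same.
    case: (e v u) => //=; have [Lu|//] := eqVneq (L u).+1 (L v).
    rewrite /=; have [[-> ->] //|[[-> /negbTE -> _ ->] ]] := stable u Lu.
    by rewrite andbF.
  have bv : blue th (L v) (rk (st v)) by rewrite /blue vw /=; apply/eqP; lia.
  have bvI : bl (blue th) st v by rewrite blE.
  (* Red layers of one step agree modulo 3 and neighbours are at most one layer apart, so the red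
     neighbours of [v] are those one layer above. *)
  have redE u : e v u -> red th (L u) = ((L u).+1 == L v).
    move=> vu; apply/idP/eqP => [ru|Lu].
      have := red_mod w0 ru; have := blue_mod w0 bv.
      have := L_adj vu; have : L v <= (L u).+1 by apply: L_adj; rewrite e_sym.
      lia.
    by have /andP[] := blue_red w0 bv; rewrite -Lu.
  have [[u [ru vu h]]|h] := po_good P bvI.
    left; exists u; split; rewrite ?same //.
    by apply/eqP; rewrite -redE // -rdE.
  right; rewrite -h; apply: eq_card => u; rewrite !inE rdE same.
  by case vu: (e v u) => //=; rewrite redE.
move=> l.
have WE s : wt st l s = W l s by apply: eq_bigl => u; rewrite lE.
have := po_wt P l; rewrite !WE => /leq_trans; apply.
apply: leq_trans (leq_add (pl_W H l) (leqnn _)) _.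
rewrite -addnA leq_add2l /wtA.
have same v : L v = l.+1 -> l.+1 %% w != 0 -> key l < th + 3 * rk (st v) -> rk (st' v) = rk (st v).
  move=> Lv lw K; have [[]//|[Kv r0 f0 _]] := chg v.
  by have := key_gap w0 lw; rewrite Lv /= in Kv *; lia.
rewrite [X in _ + X <= _](eq_bigl (fun v => [&& L v == l.+1, l.+1 %% w != 0 & key l == th + 3 * rk (st v)])); last first.
  by move=> v; rewrite lE blE /blue; case: eqP => //= ->.
rewrite [X in X + _ <= _](eq_bigr (fun v => 2 ^ rk (st' v))); last first.
  by move=> v /and3P[lw /eqP Lv K]; rewrite (same v).
rewrite [X in _ + X <= _](eq_bigr (fun v => 2 ^ rk (st' v))); last first.
  move=> v /and3P[/eqP Lv lw /eqP K]; rewrite bl_same //.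
  by rewrite Lv /blue lw /= K eqxx.
rewrite big_mkcond [X in _ + X]big_mkcond [X in _ <= X]big_mkcond -big_split /=.
apply: leq_sum => v _; rewrite addSn ltnS.
case lw: (l.+1 %% w != 0) => /=; last by rewrite andbF.
case: eqP => //= Lv.
have [K|K|K] := ltngtP (key l) (th + 3 * rk (st v)) => //=.
- by rewrite (same v) // addn0 (ltnW K).
- rewrite add0n bl_same ?K ?leqnn //.
  by rewrite Lv /blue lw /= K eqxx.
Qed.

Definition peps : rat := (q.+1%:R * (#|V|%:R * dr ^+ q) + hr ^+ q * #|V|%:R)%R.

Lemma peps_ge0 : (0 <= peps)%R.
Proof.
by apply: addr_ge0; do ?apply: mulr_ge0; rewrite ?dr_exp_ge0 ?hr_exp_ge0 ?ler0n.
Qed.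

Lemma pipe_proc th st : Pipe th st -> (fail e (proc th) (Pipe th.+1) st <= peps)%R.
Proof.
move=> H.
have lE v : lay (st v) = L v by apply: pl_lay H v.
have rdE u : rd (red th) st u = red th (L u) by rewrite /rd lE.
have blE v : bl (blue th) st v = blue th (L v) (rk (st v)) by rewrite /bl lE.
apply: le_trans (_ : fail e (proc th) (Post (red th) (rrf th) (blue th) e st) st <= _)%R.
  by apply: fail_imp; apply: alw_true => s; apply: Pipe_step.
apply: (proc_fail q e_sym _ _ nb0 LaE Vlam lamnb).
- move=> v; rewrite blE rdE => bv; apply/negP => rv.
  move: (red_mod w0 rv) (blue_mod w0 bv); have [] := blueP bv; lia.
- move=> u v; rewrite blE rdE /rI !lE => ru bv uv.
  have E : (L u).+1 = L v.
    have := red_mod w0 ru; have := blue_mod w0 bv; have [v0 _ _] := blueP bv.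
    have := L_adj uv; have : L u <= (L v).+1 by apply: L_adj; rewrite e_sym.
    lia.
  split=> //; have /andP[_ /eqP] := blue_red w0 bv.
  by rewrite -E.
- move=> u; rewrite rdE /rI lE => ru.
  have [|h] := pl_rk H u; first by left.
  by right; have := redP w0 ru; lia.
- move=> v; rewrite blE => bv; have [v0 vw _] := blueP bv.
  have [u vu Lu] := L_up v0; exists u => //.
  by rewrite rdE; have /andP[] := blue_red w0 bv; rewrite -Lu.
Qed.

Record Ready (st : cfg) : Prop := {
  rd_lay : forall v, lay (st v) = L v;
  rd_msg : forall v, msg (st v) = M v;
  rd_rk : forall v, rk (st v) <= lam;
  rd_good : forall v, L v %% w != 0 -> good st v
}.

(** Chaining [pl_W] over the layers from [l] on bounds the weight of layer [l] by the number of
    nodes in them; hence 2^rank <= [#|V|] <= 2^lam. *)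
Lemma Pipe_ready st : Pipe (6 * w) st -> Ready st.
Proof.
move=> H; split; [exact: pl_lay H|exact: pl_msg H| |]; last first.
  by move=> v vw; apply: (pl_good H vw); have := key_lt w0 (L v).-1; lia.
have [D HD] : exists D, forall v, L v < D.
  by exists (\max_v L v).+1 => v; rewrite ltnS leq_bigmax.
have WD k l : l + k = D -> W l st <= #|[set v | l <= L v]|.
  elim: k l => [|k IH] l lk.
    by rewrite /W big1 // => v /eqP; have := HD v; lia.
  apply: leq_trans (pl_W H l) _.
  apply: leq_trans (_ : #|[set v | L v == l]| + W l.+1 st <= _).
    rewrite leq_add2l /W big_mkcond [X in _ <= X]big_mkcond; apply: leq_sum => v _.
    by case: (_ != 0) => //=; case: (_ == _) => //=; case: ifP.
  apply: leq_trans (leq_add (leqnn _) (IH l.+1 _)) _; first by lia.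
  rewrite -cardsUI [X in _ + X]eq_card0 ?addn0 => [|v]; last by rewrite !inE; lia.
  by apply: subset_leq_card; apply/subsetP => v; rewrite !inE; lia.
move=> v; rewrite -(@leq_exp2l 2) //; apply: leq_trans Vlam.
apply: leq_trans (max_card (mem [set u | L v <= L u])).
apply: leq_trans (WD (D - L v) _ _); last by have := HD v; lia.
by rewrite /W (bigD1 v) //= leq_addr.
Qed.

Lemma pipeline_fail st :
  (forall v, [/\ lay (st v) = L v, msg (st v) = M v, rk (st v) = 0 & ~~ fs (st v)]) ->
  (fail e pipeline Ready st <= (6 * w)%N%:R * peps)%R.
Proof.
move=> H; apply: le_trans (_ : fail e pipeline (Pipe (0 + 6 * w)%N) st <= _)%R.
  by apply: fail_imp; apply: alw_true => s; apply: Pipe_ready.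
apply: fail_iota; first exact: peps_ge0.
  by move=> th s _; apply: pipe_proc.
split=> [v|v|v|v vw|l].
- by have [] := H v.
- by have [] := H v.
- by left; have [] := H v.
- by have [_ _ -> _] := H v; have := key_gap w0 vw; lia.
rewrite /W (eq_bigr (fun=> 1)) => [|u _]; last by have [_ _ -> _] := H u.
by rewrite sum1dep_card leq_addr.
Qed.

End Pipeline.

(** * Transmitting the message in packets *)

Section Encoding.
Variable B : nat.

(* The final [true] marks the end of the message; padding is by [false]. *)
Definition enc (m : message) : seq bool := rcons m true.
Definition pkt k (m : message) : packet B := [tuple nth false (enc m) (k * B + i) | i < B].
Definition dec (b : seq (packet B)) : message :=
  let s := flatten [seq val p | p <- b] in take ((size s).-1 - index true (rev s)) s.

Lemma val_pkt k m : val (pkt k m) = [seq nth false (enc m) i | i <- iota (k * B) B].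
Proof.
apply: (@eq_from_nth _ false); first by rewrite size_tuple size_map size_iota.
move=> i; rewrite size_tuple => iB.
rewrite (nth_map 0) ?size_iota // nth_iota //.
by rewrite -[i]/(val (Ordinal iB)) -tnth_nth tnth_mktuple.
Qed.

Lemma flatten_pkt m n :
  flatten [seq val p | p <- [seq pkt k m | k <- iota 0 n]] = mkseq (nth false (enc m)) (n * B).
Proof.
elim: n => [|n IH]; first by rewrite mul0n.
rewrite -addn1 iotaD !map_cat flatten_cat IH add0n.
rewrite [flatten (map _ (map _ (iota n 1)))](_ : _ = val (pkt n m) ++ [::]) // cats0.
by rewrite val_pkt mulnDl mul1n /mkseq iotaD map_cat add0n.
Qed.

Lemma dec_pkt m n : size m < n * B -> dec [seq pkt k m | k <- iota 0 n] = m.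
Proof.
move=> mn; rewrite /dec flatten_pkt.
have -> : mkseq (nth false (enc m)) (n * B) = rcons m true ++ nseq (n * B - (size m).+1) false.
  apply: (@eq_from_nth _ false).
    by rewrite size_mkseq size_cat size_rcons size_nseq; lia.
  move=> i; rewrite size_mkseq => iB; rewrite nth_mkseq // nth_cat size_rcons /enc.
  by case: ltnP => // mi; rewrite nth_nseq if_same nth_default // size_rcons.
rewrite rev_cat rev_nseq rev_rcons index_cat mem_nseq andbF /= addn0 !size_cat size_rcons !size_nseq.
have -> : (size m).+1 + (n * B - (size m).+1) = (n * B) by lia.
rewrite -cats1 -catA take_cat (_ : (_ - _) = size m); last by lia.
by rewrite ltnn subnn /= cats0.
Qed.

End Encoding.

Section Transmission.
Variables (B nb mu : nat) (V : finType) (e : rel V).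
Notation node := (node B).
Notation cfg := (V -> node).
Notation instr := (instr B nb node).

Definition sett (s : node) f m b : node :=
  Node (lay s) (rk s) (fs s) (inR s) (inA s) (smp s) (asg s) (cnt s) f m b.

Definition tx_start (sel : node -> nb.-tuple bool -> bool) : instr :=
  beep (fun _ _ => false) (fun s w _ => sett s (sel s w && isSome (msg s)) (msg s) [::]).

Definition tx_send k : instr :=
  Instr (fun s _ => if flg s then omap (pkt B k) (msg s) else None)
        (fun s _ f => if f is Received p then sett s (flg s) (msg s) (rcons (buf s) p) else s).

Definition tx_end : instr :=
  beep (fun _ _ => false) (fun s _ _ =>
    sett s (flg s) (if ~~ isSome (msg s) && (size (buf s) == mu.+1) then Some (dec (buf s)) else msg s) [::]).

Definition tx_rest := flatten [seq [:: tx_send k] | k <- iota 0 mu.+1] ++ [:: tx_end].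
Definition TX sel := tx_start sel :: tx_rest.

Variable m : message.
Hypothesis m_size : size m < mu.+1 * B.

(** The senders are fixed once, by the coins of [tx_start], so the channel behaves alike for all
    packets: a silent node receives either all [mu.+1] of them or none. *)
Lemma TX_spec sel st (w : cointype nb V) :
  (forall v, msg (st v) = None \/ msg (st v) = Some m) ->
  let fl u := sel (st u) (w u) && isSome (msg (st u)) in
  alw e tx_rest (fun st' => forall v,
    (lay (st' v), rk (st' v), fs (st' v)) = (lay (st v), rk (st v), fs (st v)) /\
    msg (st' v) = if isSome (msg (st v)) || (#|[set u | e v u && fl u]| == 1)
                  then Some m else None)
  (gstep e (tx_start sel) st w).
Proof.
move=> Hm fl; set s1 := gstep _ _ _ _.
have E1 v : s1 v = sett (st v) (fl v) (msg (st v)) [::] by rewrite /s1 gstep_beep.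
clearbody s1.
pose P k (s : cfg) := forall v,
  [/\ (lay (s v), rk (s v), fs (s v)) = (lay (st v), rk (st v), fs (st v)),
      flg (s v) = fl v, msg (s v) = msg (st v) &
      ~~ fl v -> buf (s v) = if #|[set u | e v u && fl u]| == 1
                             then [seq pkt B i m | i <- iota 0 k] else [::]].
have P0 : P 0 s1 by move=> v; rewrite E1; split=> //= _; case: ifP.
apply/alw_cat.
have A : alw e (flatten [seq [:: tx_send k] | k <- iota 0 mu.+1]) (P mu.+1) s1.
  apply: (alw_iota (Inv := P) (a := 0)) P0 => k s _ Hs w'.
  suff: P k.+1 (gstep e (tx_send k) s w') by [].
  move=> v; have [h1 h2 h3 h4] := Hs v.
  rewrite /gstep; set acts := fun u => iact (tx_send k) (s u) (w' u).
  have aE u : acts u = if fl u then Some (pkt B k m) else None.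
    rewrite /acts /=; have [_ -> -> _] := Hs u.
    case fu: (fl u) => //; move: fu; rewrite /fl => /andP[_].
    by have [->|->] := Hm u.
  have sE : [set u | e v u && isSome (acts u)] = [set u | e v u && fl u].
    by apply/setP => u; rewrite !inE aE; case: (fl u).
  split; try by rewrite /=; case: (hear _ _ _).
  move=> nfl; have av : acts v = None by rewrite aE (negbTE nfl).
  case: eqP => [/eqP/cards1P[x Ex]|n1].
    have fx : fl x by have := set11 x; rewrite -Ex inE => /andP[].
    rewrite (@hearR _ _ _ _ _ x (pkt B k m)) ?aE ?fx ?(negbTE nfl) ?sE //.
    by rewrite [LHS]/= h4 // Ex cards1 eqxx -cats1 -addn1 iotaD map_cat add0n.
  have := hearE e av; rewrite sE /=; case: (hear _ _ _) => [_|p /= E|_]; rewrite ?h4 //.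
  - by case: eqP.
  - by case: n1; lia.
  - by case: eqP.
apply: alw_imp A => s Hs w'; suff: forall v,
    (lay (gstep e tx_end s w' v), rk (gstep e tx_end s w' v), fs (gstep e tx_end s w' v))
       = (lay (st v), rk (st v), fs (st v)) /\
    msg (gstep e tx_end s w' v) = if isSome (msg (st v)) || (#|[set u | e v u && fl u]| == 1)
                  then Some m else None by [].
move=> v; rewrite gstep_beep /=; have [h1 h2 h3 h4] := Hs v; split=> //.
rewrite h3; have [Em|Em] := Hm v; rewrite Em //=.
have nfl : ~~ fl v by rewrite /fl Em andbF.
rewrite h4 //; have [_|//] := eqVneq #|[set u | e v u && fl u]| 1.
by rewrite size_map size_iota eqxx dec_pkt.
Qed.

End Transmission.

(** * The timetable of the broadcast *)

Section Slots.
Variables (beta lam w : nat).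
Hypotheses (beta2 : 2 < beta) (w0 : 0 < w).

Definition ringrank l r := lam.+1 * (l %/ w) + (lam - r).
(** The factor 4 reserves residue 0 for marked transmissions and residues 1 to 3 for Decay in the
    layers of each class modulo 3. A unit of [ringrank] leaves room for [beta] Decay slots of one
    class. *)
Definition slot l r := 4 * (l + beta * ringrank l r).

Lemma mul_sep a b x y : a <= x + 2 -> x <= a + 2 ->
  a + beta * b = x + beta * y -> a = x /\ b = y.
Proof.
move=> ax xa E; have [lt|lt|Eb] := ltngtP b y.
- have : beta * b.+1 <= beta * y by rewrite leq_mul2l lt orbT.
  by rewrite mulnS => ?; exfalso; lia.
- have : beta * y.+1 <= beta * b by rewrite leq_mul2l lt orbT.
  by rewrite mulnS => ?; exfalso; lia.
- by rewrite Eb in E; split=> //; lia.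
Qed.

Lemma mul_sep_lt a b x y : a < beta -> x < beta ->
  beta * b + a = beta * y + x -> a = x /\ b = y.
Proof.
move=> ax xa E; have [lt|lt|Eb] := ltngtP b y.
- have : beta * b.+1 <= beta * y by rewrite leq_mul2l lt orbT.
  by rewrite mulnS => ?; exfalso; lia.
- have : beta * y.+1 <= beta * b by rewrite leq_mul2l lt orbT.
  by rewrite mulnS => ?; exfalso; lia.
- by rewrite Eb in E; split=> //; lia.
Qed.

(** Nodes with a common neighbour are at most two layers apart; since [2 < beta], such a difference
    cannot make up for one in [ringrank]. *)
Lemma slot_inj l r l' r' : r <= lam -> r' <= lam -> l <= l' + 2 -> l' <= l + 2 ->
  slot l r = slot l' r' -> l = l' /\ r = r'.
Proof.
move=> rl rl' h1 h2 E; have E' : l + beta * ringrank l r = l' + beta * ringrank l' r'.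
  by move: E; rewrite /slot; lia.
have [El R] := mul_sep h1 h2 E'; split=> //.
by move: R; rewrite /ringrank El; lia.
Qed.

(** The gap is long enough for a complete Decay, [beta] slots at distance 4, by neighbours of larger
    rank. *)
Lemma slot_same l r r' : l.+1 %% w != 0 -> r < r' <= lam ->
  slot l r' + 4 * beta <= slot l.+1 r.
Proof.
rewrite -/(dvdn w l.+1) => lw /andP[rr rl]; rewrite /slot /ringrank divnS // (negbTE lw) add0n.
have -> : lam - r = (lam - r') + (r' - r) by lia.
rewrite addnA (mulnDr beta _ (r' - r)).
have : beta <= beta * (r' - r) by rewrite leq_pmulr // subn_gt0.
lia.
Qed.

Lemma slot_fast l r : l.+1 %% w != 0 -> slot l.+1 r = slot l r + 4.
Proof.
rewrite -/(dvdn w l.+1) => lw; rewrite /slot /ringrank divnS // (negbTE lw) add0n; lia.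
Qed.

(** Entering a ring adds [lam.+1] to [ringrank], which outweighs any gain in rank. *)
Lemma slot_cross l r r' : l.+1 %% w = 0 -> r <= lam -> r' <= lam ->
  slot l r' + 4 * beta <= slot l.+1 r.
Proof.
move=> /eqP; rewrite -/(dvdn w l.+1) => lw rl rl'.
rewrite /slot /ringrank divnS // lw add1n mulnS.
set A := lam.+1 * (l %/ w).
have : beta * (A + (lam - r')).+1 <= beta * (lam.+1 + A + (lam - r)).
  by rewrite leq_mul2l; apply/orP; right; lia.
rewrite mulnS; lia.
Qed.

Lemma slot_le l r D : l <= D -> slot l r <= 4 * (D + beta * (lam.+1 * (D %/ w) + lam)).
Proof.
move=> lD; rewrite /slot leq_mul2l leq_add // leq_mul2l leq_add ?leq_subr ?orbT //.
by rewrite leq_mul2l leq_div2r ?orbT.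
Qed.

End Slots.

(** * The probability that some node misses its deadline *)

Section Broadcast.
Variables (B nb mu La q w lam : nat).
Notation node := (node B).
Notation beta := (La * q).
Notation slot := (slot beta lam w).

Definition sel y (s : node) (c : nb.-tuple bool) : bool :=
  let F := slot (lay s) (rk s) in
  (fs s && (y == F)) ||
  [&& F < y, (y - F) %% 4 == (lay s %% 3).+1, (y - F) %/ 4 < beta &
      low (((y - F) %/ 4) %% La) c].

Definition bcast n := flatten [seq TX mu (sel y) | y <- iota 0 n].

Variables (V : finType) (e : rel V) (L : V -> nat) (m : message).
Hypotheses (beta2 : 2 < beta) (w0 : 0 < w).
Hypothesis e_sym : symmetric e.
Hypothesis L_adj : forall u v, e u v -> L v <= (L u).+1.
Hypothesis L_up : forall v, 0 < L v -> exists2 u, e v u & (L u).+1 = L v.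
Hypotheses (LaE : La = lam.+1) (Vlam : #|V| <= 2 ^ lam) (lamnb : lam <= nb).
Hypothesis m_size : size m < mu.+1 * B.
Variables (st0 : V -> node).
Hypothesis lay0 : forall v, lay (st0 v) = L v.
Hypothesis rk0 : forall v, rk (st0 v) <= lam.
Hypothesis good0 : forall v, L v %% w != 0 -> good e L st0 v.
Notation cfg := (V -> node).
Notation r v := (rk (st0 v)).
Notation F v := (slot (L v) (r v)).

Definition Lin (st : cfg) := forall v,
  (lay (st v), rk (st v), fs (st v)) = (L v, r v, fs (st0 v)) /\
  [/\ msg (st v) = None \/ msg (st v) = Some m & (L v = 0 -> msg (st v) = Some m)].

Definition Inv y (st : cfg) := forall v, F v <= y -> msg (st v) = Some m.

Definition unf (st : cfg) v : rat := (~~ isSome (msg (st v)))%:R%R.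

Lemma Lin_TX y st : Lin st -> alw e (TX mu (sel y)) (fun st' => Lin st' /\
   forall v, isSome (msg (st v)) -> isSome (msg (st' v))) st.
Proof.
move=> H c; have Hm v : msg (st v) = None \/ msg (st v) = Some m by have [_ []] := H v.
apply: alw_imp (TX_spec e m_size (sel y) c Hm) => st' H'.
split=> v; have [h1 h2] := H' v; have [h3 [h4 h5]] := H v; last by rewrite h2 => ->.
rewrite h1 h2; split=> //; split; first by case: ifP; auto.
by move=> /h5 ->.
Qed.

Definition flagged y (c : cointype nb V) (st : cfg) u :=
  sel y (st u) (c u) && isSome (msg (st u)).

Lemma unf_TX y st v (f : cointype nb V -> bool) : Lin st ->
  (forall c, ~~ f c -> #|[set u | e v u && flagged y c st u]| = 1) ->
  (Ex e (TX mu (sel y)) (fun s => unf s v) st <= avg (fun c => (f c)%:R))%R.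
Proof.
move=> H Hf; apply: (@avg_le _ (coin_gt0 nb V) (fun c => Ex e (tx_rest B nb mu)
  (fun s => unf s v) (gstep e (tx_start (sel y)) st c))) => c.
have Hm u : msg (st u) = None \/ msg (st u) = Some m by have [_ []] := H u.
apply: Ex_le_const; apply: alw_imp (TX_spec e m_size (sel y) c Hm) => st' H'.
rewrite /unf; have [_ ->] := H' v; rewrite -/(flagged y c st _).
case fc: (f c); first by case: ifP; rewrite /= ?lexx ?ler01.
have -> : #|[set u | e v u && (sel y (st u) (c u) && isSome (msg (st u)))]| = 1.
  by apply: Hf; rewrite fc.
by rewrite orbT.
Qed.

Lemma selE y st u (c : nb.-tuple bool) : Lin st ->
  sel y (st u) c = (fs (st0 u) && (y == F u)) ||
  [&& F u < y, (y - F u) %% 4 == (L u %% 3).+1, (y - F u) %/ 4 < beta &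
      low (((y - F u) %/ 4) %% La) c].
Proof. by move=> H; rewrite /sel; have [[-> -> ->] _] := H u. Qed.

(* [b v y] bounds the probability that [v] misses its deadline, given that it is
   uninformed in slot [y] while all earlier deadlines were met. *)
Definition bound v (b : nat -> rat) : Prop := [/\
  forall y, (0 <= b y)%R, 0 < L v -> (b 0%N <= dr ^+ q)%R,
  forall y, F v <= y -> (1 <= b y)%R &
  forall y st, Lin st -> Inv y st -> msg (st v) = None ->
    (Ex e (TX mu (sel y)) (fun s => unf s v) st * b y.+1 <= b y)%R].

Lemma unf_le1 y st v : (Ex e (TX mu (sel y)) (fun s => unf s v) st <= 1)%R.
Proof. by apply: Ex_le_const; apply: alw_true => s; rewrite lern1 leq_b1. Qed.

Lemma adj2 u v x : e v u -> e v x -> L u <= L x + 2 /\ L x <= L u + 2.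
Proof.
move=> vu vx; have := L_adj vu; have := L_adj vx.
by rewrite e_sym in vu; rewrite e_sym in vx; have := L_adj vu; have := L_adj vx; lia.
Qed.

Lemma bound_fast v : L v %% w != 0 ->
  #|[set u | [&& e v u, (L u).+1 == L v, r u == r v & fs (st0 u)]]| = 1 ->
  exists b, bound v b.
Proof.
move=> vw /eqP/cards1P[u Eu].
have := set11 u; rewrite -Eu inE => /and4P[vu /eqP Lu /eqP ru fu].
have FE : F v = F u + 4 by rewrite -Lu -ru slot_fast ?Lu.
(* The marked neighbour [u] informs [v] with certainty in slot [F u]: other marked neighbours of [v]
   sending then would share the layer and rank of [u], and Decay uses other residues. *)
exists (fun y => if y <= F u then 0%R else 1%R); split=> [y|_|y yF|y st H I _].
- by case: ifP.
- by rewrite leq0n dr_exp_ge0.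
- by rewrite ifF //; lia.
have [yu|yu] := leqP y.+1 (F u); first by rewrite mulr0 (ltnW yu).
rewrite mulr1; have [Ey|ny] := eqVneq y (F u); last first.
  by rewrite ifF; [exact: unf_le1|lia].
rewrite Ey leqnn -Ey.
apply: le_trans (unf_TX (f := fun=> false) (v := v) H _) _; last first.
  by rewrite avg_const ?coin_gt0.
move=> c _; rewrite (_ : [set _ | _] = [set u]) ?cards1 //; apply/setP => x; rewrite !inE.
have [->|xu] := eqVneq x u.
  rewrite vu /flagged (selE _ _ _ H) fu Ey eqxx /=.
  by rewrite I // Ey.
apply/negP => /andP[vx /andP[]]; rewrite (selE _ _ _ H) => /orP[/andP[fx /eqP yx] _|].
  have [h1 h2] := adj2 vx vu.
  have [Lx rx] := slot_inj beta2 w0 (rk0 x) (rk0 u) h1 h2 (esym (etrans (esym Ey) yx)).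
  have : x \in [set u] by rewrite -Eu inE vx Lx Lu eqxx rx ru eqxx fx.
  by rewrite inE (negbTE xu).
by case/and4P=> h1 /eqP h2 _ _; move: h1 h2; rewrite Ey /slot; lia.
Qed.

Lemma bound_slow v u0 : e v u0 -> (L u0).+1 = L v -> F u0 + 4 * beta <= F v ->
  exists b, bound v b.
Proof.
move=> vu0 Lu0 FF; set l := L u0 in Lu0 FF *; set r' := r u0 in FF *.
pose X := [set u | [&& e v u, L u == l & r u == r']].
have [|j jl Xj] := @scale_exists #|X| lam.
  rewrite (leq_trans (max_card _) Vlam) andbT.
  by apply/card_gt0P; exists u0; rewrite inE vu0 !eqxx.
have jLa : j < La by rewrite LaE.
set Fp := slot l r' in FF *.
pose tm i := Fp + 4 * i + (l %% 3).+1.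
pose P y i := (i %% La == j) && (y <= tm i).
(* The exponent counts the Decay slots of the right scale still to come; each of them fails with
   probability at most [dr]. *)
exists (fun y => dr ^+ count (P y) (iota 0 beta))%R; split=> [y|_|y yF|y st H I Nv].
- exact: dr_exp_ge0.
- rewrite -{2}(count_scale q jLa) (eq_count (a2 := fun i => i %% La == j)) // => i.
  by rewrite /P leq0n andbT.
- rewrite (_ : count _ _ = 0) ?expr0 //; apply/eqP.
  rewrite -leqn0 leqNgt -has_count; apply/hasP => -[i]; rewrite mem_iota => ib /andP[_].
  by rewrite /tm; lia.
have [/hasP[i0 ib /andP[/eqP ij /eqP yi]]|Nh] :=
    boolP (has (fun i => (i %% La == j) && (y == tm i)) (iota 0 beta)).
  rewrite mem_iota in ib.
  have Hdr : (Ex e (TX mu (sel y)) (fun s => unf s v) st <= dr)%R.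
    have jn : j <= nb by apply: leq_trans jl lamnb.
    apply: le_trans (avg_decay jn Xj).
    apply: (unf_TX (f := fun c : cointype nb V => #|[set u in X | low j (c u)]| != 1)) => // c.
    rewrite negbK => /eqP Ec; rewrite -[RHS]Ec; apply: eq_card => u; rewrite !inE.
    case vu: (e v u) => //=; rewrite /flagged (selE _ _ _ H).
    have yF u' : (y == F u') = false.
      by apply/eqP; rewrite yi /tm /Fp /slot; lia.
    rewrite yF andbF /=.
    apply/andP/andP => [[/and4P[h1 /eqP h2 h3 h4] _]|[/andP[/eqP Lu /eqP ru] lu]].
      have [a1 a2] := adj2 vu vu0.
      have Lu : L u = l by move: h1 h2; rewrite yi /tm /Fp /slot; lia.
      have E : beta * ringrank lam w (L u) (r u) + (y - F u) %/ 4 = beta * ringrank lam w l r' + i0.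
        move: h1 h2 h3; rewrite yi /tm /Fp /slot Lu; lia.
      (* Both operation numbers are below [beta], so the slot determines the rank too: the senders
         are the nodes of [X] that drew [low j]. *)
      have [Ei ER] := mul_sep_lt beta2 w0 h3 (ib : i0 < beta) E.
      rewrite -ij -Ei h4 Lu eqxx; split=> //=; apply/eqP.
      by move: ER; rewrite /ringrank Lu; have := rk0 u; have := rk0 u0; rewrite -/r'; lia.
    rewrite Lu ru -/Fp.
    have -> : (y - Fp) %/ 4 = i0 by rewrite yi /tm; lia.
    have -> : (y - Fp) %% 4 = (l %% 3).+1 by rewrite yi /tm; lia.
    rewrite eqxx ij lu I ?Lu ?ru -/Fp; last by rewrite yi /tm; lia.
    by split=> //; rewrite yi /tm /=; lia.
  have cP : count (P y) (iota 0 beta) <= (count (P y.+1) (iota 0 beta)).+1.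
    apply: leq_trans (_ : count (predU (P y.+1) (pred1 i0)) (iota 0 beta) <= _).
      apply: sub_count => i; rewrite /P /= => /andP[-> h] /=.
      move: h; rewrite yi /tm; lia.
    apply: leq_trans (_ : count (P y.+1) (iota 0 beta) + count_mem i0 (iota 0 beta) <= _).
      by rewrite -count_predUI leq_addr.
    by rewrite count_uniq_mem ?iota_uniq //; case: (_ \in _); rewrite ?addn1 ?addn0.
  apply: le_trans (ler_wpM2r (dr_exp_ge0 _) Hdr) _; rewrite -exprS.
  by apply: ler_wiXn2l cP; [exact: dr_ge0|exact: dr_le1].
apply: le_trans (ler_wpM2r (dr_exp_ge0 _) (unf_le1 y st v)) _; rewrite mul1r.
apply: ler_wiXn2l; [exact: dr_ge0|exact: dr_le1|].
rewrite (eq_in_count (a2 := P y.+1)) // => i ib; rewrite /P.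
case ij: (_ == j) => //=.
have /hasPn/(_ _ ib) := Nh; rewrite ij /= => yi; lia.
Qed.

Lemma bound_exists v : exists b, bound v b.
Proof.
have [Lv|Lv] := posnP (L v).
  exists (fun=> 1%R); split=> // [|y st H _]; first by rewrite Lv.
  by have [_ [_ ->]] := H v.
have [vw|vw] := eqVneq (L v %% w) 0.
  have [u vu Lu] := L_up Lv; apply: (bound_slow vu Lu).
  by rewrite -Lu; apply: slot_cross; rewrite ?Lu.
have [[u [vu Lu h]]|] := good0 vw; last exact: bound_fast.
apply: (bound_slow vu Lu).
by rewrite -Lu; apply: slot_same; rewrite ?Lu ?h ?rk0.
Qed.

Definition informed (st : cfg) := forall v, msg (st v) = Some m.

(** The sum of [b v y] over uninformed [v] is a supermartingale as long as all deadlines are met,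
    and it is at least 1 once one is missed. *)
Lemma bcast_from (b : V -> nat -> rat) n a st :
  (forall v, bound v (b v)) -> (forall v, F v <= a + n) -> Lin st -> Inv a st ->
  (fail e (flatten [seq TX mu (sel y) | y <- iota a n]) informed st
   <= \sum_v unf st v * b v a)%R.
Proof.
move=> Hb; have b0 v y : (0 <= b v y)%R by have [] := Hb v.
have u0 st' v : (0 <= unf st' v)%R by exact: ler0n.
elim: n a st => [|n IH] a st Fa H I.
  apply: le_trans (fail_alw _) _; last by apply: sumr_ge0 => v _; rewrite mulr_ge0.
  by move=> v; apply: I; have := Fa v; rewrite addn0.
rewrite [flatten _](_ : _ = TX mu (sel a) ++ flatten [seq TX mu (sel y) | y <- iota a.+1 n]) //.
rewrite /fail Ex_cat.
apply: le_trans (_ : Ex e (TX mu (sel a)) (fun s => \sum_v unf s v * b v a.+1)%R st <= _)%R.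
  apply: Ex_le; apply: alw_imp (Lin_TX a H) => s [Hs _].
  have [Is|Is] := pselect (Inv a.+1 s); first by apply: IH => // v; rewrite addSnnS.
  have [v /not_implyP[Fv Nv]] : exists v, ~ (F v <= a.+1 -> msg (s v) = Some m).
    by apply/existsNP.
  apply: le_trans (fail_le1 _ _ _ _) _; rewrite (bigD1 v) //=.
  have -> : unf s v = 1%R.
    by rewrite /unf; have [_ [[E|E] _]] := Hs v; [rewrite E|case: Nv].
  rewrite mul1r; apply: le_trans (_ : b v a.+1 <= _)%R.
    by have [_ _ Hge _] := Hb v; apply: Hge.
  by rewrite lerDl; apply: sumr_ge0 => x _; rewrite mulr_ge0.
rewrite Ex_sum; apply: ler_sum => v _.
rewrite (eq_Ex _ _ _ (g := fun s => b v a.+1 * unf s v)%R) => [|s]; last by rewrite mulrC.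
rewrite ExZ mulrC; have [_ [[Nv|Sv] _]] := H v.
  by rewrite {2}/unf Nv mul1r; have [_ _ _] := Hb v; apply.
rewrite (_ : Ex _ _ _ _ = 0%R) ?mul0r ?mulr_ge0 //; apply/eqP; rewrite eq_le; apply/andP; split.
  apply: Ex_le_const; apply: alw_imp (Lin_TX a H) => s [_ K].
  by rewrite /unf K // Sv.
by rewrite -(Ex_const e (TX mu (sel a)) 0%R st); apply: Ex_mono.
Qed.

Lemma bcast_fail n :
  (forall v, F v <= n) ->
  (forall v, msg (st0 v) = None \/ msg (st0 v) = Some m) ->
  (forall v, L v = 0 -> msg (st0 v) = Some m) ->
  (fail e (bcast n) informed st0 <= #|V|%:R * dr ^+ q)%R.
Proof.
move=> Fn H1 H2; have [b Hb] := choice bound_exists.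
apply: le_trans (bcast_from (n := n) Hb _ _ _) _ => //.
- by move=> v; rewrite lay0; split=> //; split; auto.
- by move=> v; rewrite /slot => h; apply: H2; lia.
rewrite mulr_natl -sumr_const; apply: ler_sum => v _.
have [b0 bq _ _] := Hb v.
have [Lv|Lv] := posnP (L v).
  by rewrite /unf H2 // mul0r dr_exp_ge0.
apply: le_trans (bq Lv); rewrite -[X in (_ <= X)%R]mul1r; apply: ler_wpM2r => //.
by rewrite lern1 leq_b1.
Qed.

End Broadcast.

(** * The algorithm *)

Section Distance.
Variables (V : finType) (e : rel V) (s : V).
Hypothesis conn : forall u v, connect e u v.
Notation L := (dist e s).

Lemma dist_walk v : walk e s v (L v).
Proof. by have [] := distP (conn s v). Qed.

Lemma dist_min v k : walk e s v k -> L v <= k.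
Proof. by have [_] := distP (conn s v); apply. Qed.

Lemma dist_adj u v : e u v -> L v <= (L u).+1.
Proof.
move=> uv; apply: dist_min; have /existsP[p /andP[pp /eqP lp]] := dist_walk u.
apply/existsP; exists [tuple of rcons p v].
by rewrite /= rcons_path pp lp uv last_rcons eqxx.
Qed.

Lemma dist_up v : symmetric e -> 0 < L v -> exists2 u, e v u & (L u).+1 = L v.
Proof.
move=> e_sym; have /existsP[p /andP[pp /eqP lp]] := dist_walk v.
have := size_tuple p; case/lastP: (tval p) pp lp => [_ _ <- //|p' x].
rewrite rcons_path last_rcons size_rcons => /andP[pp' ex] xv Ek _.
rewrite xv in ex; exists (last s p'); first by rewrite e_sym.
apply/eqP; rewrite eqn_leq (dist_adj ex) andbT -Ek ltnS; apply: dist_min.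
by apply/existsP; exists (in_tuple p'); rewrite pp' eqxx.
Qed.

Lemma dist_src : L s = 0.
Proof.
apply/eqP; rewrite -leqn0; apply: dist_min; apply/existsP.
by exists [tuple]; rewrite /= eqxx.
Qed.

Lemma dist_eq0 v : L v = 0 -> v = s.
Proof.
move=> L0; have := dist_walk v; rewrite L0 => /existsP[p].
by rewrite tuple0 /= => /eqP.
Qed.

Lemma dist_diameter v : L v <= diameter e.
Proof.
apply: leq_trans (@leq_bigmax _ (fun v => dist e s v) v) _.
exact: (@leq_bigmax _ (fun u => \max_v dist e u v) s).
Qed.

End Distance.

Lemma diameter_card (V : finType) (e : rel V) : diameter e <= #|V|.
Proof.
apply/bigmax_leqP => u _; apply/bigmax_leqP => v _.
by rewrite /dist -[X in _ <= X](size_iota 0) find_size.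
Qed.

(** * The beep wave *)

Section Wave.
Variables (B nb Dub : nat).
Notation node := (node B).

(** The layer [Dub.+1] stands for infinity: it exceeds every distance and no node beeps for it
    during the wave. *)
Definition node0 (x : option message) : node :=
  Node (if x is Some _ then 0 else Dub.+1) 0 false false false [::] None 0 false x [::].

Definition i_wave t : instr B nb node :=
  beep (fun s _ => lay s == t) (fun s _ n =>
    Node (if 0 < n then minn (lay s) t.+1 else lay s) (rk s) (fs s) (inR s) (inA s)
      (smp s) (asg s) (cnt s) (flg s) (msg s) (buf s)).

Definition wave := flatten [seq [:: i_wave t] | t <- iota 0 Dub].

Variables (V : finType) (e : rel V) (s : V) (m : message).
Hypothesis e_sym : symmetric e.
Hypothesis conn : forall u v, connect e u v.
Hypothesis Dub_le : diameter e <= Dub.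
Notation L := (dist e s).

Definition input v := if v == s then Some m else None.

Lemma wave_post : alw e wave (fun st => forall v,
  [/\ lay (st v) = L v, msg (st v) = input v, rk (st v) = 0 & ~~ fs (st v)])
  (fun v => node0 (input v)).
Proof.
pose P t (st : V -> node) := forall v, [/\ lay (st v) = (if L v <= t then L v else Dub.+1),
  msg (st v) = input v, rk (st v) = 0 & ~~ fs (st v)].
have LD v : L v <= Dub by apply: leq_trans (dist_diameter e s v) Dub_le.
suff A : alw e wave (P Dub) (fun v => node0 (input v)).
  by apply: alw_imp A => st H v; have := H v; rewrite LD.
apply: (alw_iota (Inv := P) (a := 0)) => [t st tD H w|v]; last first.
  split=> //; rewrite /node0 /input leqn0; have [->|vs] := eqVneq v s.
    by rewrite (dist_src s conn) eqxx.
  by case: eqP => // /(dist_eq0 conn) E; rewrite E eqxx in vs.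
suff: P t.+1 (gstep e (i_wave t) st w) by [].
move=> v; rewrite gstep_beep /=; have [h1 h2 h3 h4] := H v; split=> //.
have txE u : (lay (st u) == t) = (L u == t).
  by have [-> _ _ _] := H u; case: leqP => //; lia.
have [tv|tv] := boolP (lay (st v) == t).
  by rewrite /nbeep tv (eqP tv); move: tv; rewrite txE => /eqP ->; rewrite leqnSn.
case: (@nbeep_gt0 _ e (fun u => lay (st u) == t) v tv) => [[u vu]|N].
  rewrite txE => /eqP Lu; have := dist_adj s conn (etrans (e_sym u v) vu); rewrite Lu => Lv.
  by rewrite h1 Lv; case: leqP; lia.
rewrite h1; case: leqP => [Lv|Lv]; first by rewrite leqW.
case: leqP => // Lv'; have Lv0 : 0 < L v by lia.
have [u vu Lu] := dist_up conn e_sym Lv0.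
by case: N; exists u => //; rewrite txE; apply/eqP; lia.
Qed.

End Wave.

(** * The complete program, its length and its failure probability *)

Section Algorithm.
Variables (mu kap N Dub B : nat).
Definition p_lam := up_log 2 N.
Definition p_La := p_lam.+1.
Definition p_q := kap * p_La.
(** This width keeps [Dub %/ p_w] below or equal to [p_La ^ 3], and [p_w * p_La ^ 3], the order of
    the ranking time, within [Dub + p_La ^ 3]. *)
Definition p_w := (Dub %/ p_La ^ 3).+1.
Definition p_end := 4 * (Dub + (p_La * p_q) * (p_La * (Dub %/ p_w) + p_lam)).

Definition program : seq (instr B p_La (node B)) :=
  wave B p_La Dub ++ (pipeline B p_La p_La p_q p_w ++ bcast B p_La mu p_La p_q p_w p_lam p_end).

Definition broadcast : protocol B := prog_protocol program (@node0 B Dub) (@msg B).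

Lemma size_flatten_const (I T : Type) (f : I -> seq T) c (r : seq I) :
  (forall i, size (f i) = c) -> size (flatten [seq f i | i <- r]) = size r * c.
Proof. by move=> H; elim: r => //= i r IH; rewrite size_cat H IH mulSn. Qed.

Lemma size_flatten_nseq (T : Type) (p : seq T) n : size (flatten (nseq n p)) = n * size p.
Proof. by elim: n => //= n IH; rewrite size_cat IH mulSn. Qed.

Lemma size_ops La q : size (ops B p_La La q) = La * q * 2.
Proof. by rewrite /ops (size_flatten_const (c := 2)) ?size_iota. Qed.

Lemma size_replies La q : size (replies B p_La La q) = La * q.
Proof. by rewrite /replies (size_flatten_const (c := 1)) ?size_iota ?muln1. Qed.

Lemma size_proc La q red rr blue :
  size (proc B p_La La q red rr blue) = 4 + 2 * (La * q) + q * (3 * (La * q) + 3).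
Proof.
rewrite /proc /= size_cat size_flatten_nseq /epoch size_cat /assign /=.
rewrite !size_cat /= ?size_cat size_ops size_replies /=; lia.
Qed.

(** The summands of the constant belong to the wave, the ranking and the broadcast; one slot of the
    broadcast takes [mu.+3] rounds. *)
Lemma size_program : 0 < kap ->
  size program <= (1 + 72 * kap ^ 2 + 8 * kap * mu.+3) * (Dub + p_La ^ 6).
Proof.
move=> k0.
have S1 : size (wave B p_La Dub) = Dub.
  by rewrite /wave (size_flatten_const (c := 1)) // size_iota muln1.
have S2 : size (pipeline B p_La p_La p_q p_w) =
    6 * p_w * (4 + 2 * (p_La * p_q) + p_q * (3 * (p_La * p_q) + 3)).
  rewrite /pipeline (size_flatten_const (c := 4 + 2 * (p_La * p_q) + p_q * (3 * (p_La * p_q) + 3))).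
    by rewrite size_iota.
  by move=> th; apply: size_proc.
have S3 : size (bcast B p_La mu p_La p_q p_w p_lam p_end) = p_end * mu.+3.
  rewrite /bcast (size_flatten_const (c := mu.+3)) ?size_iota // => y.
  rewrite /TX /tx_rest -cat1s !size_cat (size_flatten_const (c := 1)) // size_iota /=.
  by lia.
rewrite /program size_cat (size_cat (pipeline B p_La p_La p_q p_w)) S1 S2 S3 /p_end /p_q.
have La0 : 0 < p_La by [].
have wLa : Dub %/ p_w <= p_La ^ 3.
  rewrite -ltnS ltn_divLR //.
  have d0 : 0 < p_La ^ 3 by rewrite expn_gt0.
  apply: leq_trans (ltn_ceil Dub d0) _.
  by rewrite [X in X <= _]mulnC leq_mul2r leqnSn orbT.
have wLa' : p_w * p_La ^ 3 <= Dub + p_La ^ 3.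
  by rewrite /p_w mulSn addnC leq_add2r leq_trunc_div.
set x := p_La in La0 wLa wLa' *; set w := p_w in wLa wLa' *.
have lx : p_lam <= x by [].
have x36 : x ^ 3 <= x ^ 6 by rewrite leq_pexp2l.
have P : 6 * w * (4 + 2 * (x * (kap * x)) + kap * x * (3 * (x * (kap * x)) + 3))
    <= 72 * kap ^ 2 * (Dub + x ^ 6).
  apply: leq_trans (_ : 6 * w * (12 * (kap ^ 2 * x ^ 3)) <= _).
    rewrite leq_mul2l; apply/orP; right.
    set k1 := kap * x; have k1g : 0 < k1 by rewrite muln_gt0 k0.
    have t1 : 0 < x * k1 by rewrite muln_gt0 La0.
    have -> : kap ^ 2 * x ^ 3 = k1 * (x * k1) by rewrite /k1; lia.
    have := leq_pmull (x * k1) k1g; have := leq_pmulr k1 t1.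
    lia.
  have -> : 6 * w * (12 * (kap ^ 2 * x ^ 3)) = 72 * kap ^ 2 * (w * x ^ 3) by lia.
  by rewrite leq_mul2l; apply/orP; right; apply: leq_trans wLa' _; rewrite leq_add2l.
have Q : 4 * (Dub + x * (kap * x) * (x * (Dub %/ w) + p_lam)) <= 8 * kap * (Dub + x ^ 6).
  have h : x * (Dub %/ w) + p_lam <= 2 * x ^ 4.
    have : x * (Dub %/ w) <= x ^ 4 by rewrite (expnS x 3) leq_mul2l wLa orbT.
    have : x <= x ^ 4 by rewrite -{1}(expn1 x) leq_pexp2l.
    lia.
  have : x * (kap * x) * (x * (Dub %/ w) + p_lam) <= x * (kap * x) * (2 * x ^ 4).
    by rewrite leq_mul2l h orbT.
  have -> : x * (kap * x) * (2 * x ^ 4) = 2 * (kap * x ^ 6) by lia.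
  have : Dub <= kap * Dub by rewrite leq_pmull.
  lia.
have Q' := leq_mul Q (leqnn mu.+3).
lia.
Qed.

Variables (V : finType) (e : rel V) (s : V) (m : message).
Hypothesis e_sym : symmetric e.
Hypothesis conn : forall u v, connect e u v.
Hypothesis VN : #|V| <= N.
Hypothesis Dub_le : diameter e <= Dub.
Hypothesis m_size : size m < mu.+1 * B.
Hypothesis kap3 : 2 < kap.

Lemma program_fail :
  (fail e program (fun st => forall v, msg (st v) = Some m)
     (fun v => node0 B Dub (if v == s then Some m else None))
   <= (6 * p_w)%N%:R * peps p_q V + #|V|%:R * dr ^+ p_q)%R.
Proof.
have Vlam : #|V| <= 2 ^ p_lam by apply: leq_trans VN (up_logP _ _).
have L_adj := dist_adj s conn.
have L_up v := dist_up (s := s) (v := v) conn e_sym.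
have n0 : (0 <= (6 * p_w)%N%:R * peps p_q V + #|V|%:R * dr ^+ p_q)%R.
  by rewrite addr_ge0 // mulr_ge0 ?peps_ge0 ?dr_exp_ge0.
rewrite -[X in (_ <= X)%R]add0r /program.
apply: (fail_cat n0 (fail_alw (wave_post B p_La (Dub := Dub) s m e_sym conn Dub_le))) => st1 H1.
apply: (fail_cat _ (pipeline_fail (w := p_w) (La := p_La) (lam := p_lam) p_q _ e_sym L_adj L_up _ _ Vlam _ H1)) => //.
  by rewrite mulr_ge0 ?dr_exp_ge0.
move=> st2 [h1 h2 h3 h4].
apply: (bcast_fail (L := dist e s)) => //.
- rewrite /p_q; have : 0 < p_La * p_La by [].
  rewrite mulnCA; nia.
- by move=> v; apply: slot_le; apply: leq_trans (dist_diameter e s v) Dub_le.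
- by move=> v; rewrite h2 /input; case: ifP; auto.
- by move=> v /(dist_eq0 conn) ->; rewrite h2 /input eqxx.
Qed.

End Algorithm.

(** * Numerical estimates for the choice of constants *)

Section Arithmetic.

Lemma dr16 : (dr ^+ 16 <= 1/2)%R.
Proof.
have sq (x y : rat) : (0 <= x)%R -> (x <= y)%R -> (x ^+ 2 <= y ^+ 2)%R.
  by move=> x0 xy; rewrite lerXn2r // nnegrE // (le_trans x0).
have d2 : (dr ^+ 2 <= 9/10)%R by rewrite /dr expr2; lra.
have d4 : (dr ^+ 4 <= 81/100)%R.
  rewrite (exprM dr 2 2); apply: le_trans (sq _ _ (dr_exp_ge0 _) d2) _.
  by rewrite expr2; lra.
have d8 : (dr ^+ 8 <= 2/3)%R.
  rewrite (exprM dr 4 2); apply: le_trans (sq _ _ (dr_exp_ge0 _) d4) _.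
  by rewrite expr2; lra.
rewrite (exprM dr 8 2); apply: le_trans (sq _ _ (dr_exp_ge0 _) d8) _.
by rewrite expr2; lra.
Qed.

Lemma half_pow (y : rat) n : (0 <= y)%R -> (y <= 1/2)%R -> (y ^+ n <= ((2 ^ n)%N%:R)^-1)%R.
Proof.
by move=> y0 y1; rewrite natrX -exprVn -div1r lerXn2r // nnegrE.
Qed.

Lemma dr_pow n : (dr ^+ (16 * n) <= ((2 ^ n)%N%:R)^-1)%R.
Proof. by rewrite exprM; apply: (half_pow _ (dr_exp_ge0 16) dr16). Qed.

Lemma three_sq_le_pow4 k : 0 < k -> 3 * k ^ 2 <= 4 ^ k.
Proof.
case: k => // k _; elim: k => // k IH; rewrite (expnS 4); apply: leq_trans (_ : 4 * (3 * k.+1 ^ 2) <= _).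
  by rewrite !expnS; nia.
by rewrite leq_mul2l.
Qed.

Lemma linear_le_pow2 A c : exists z, A * (z + 3 + c) <= 2 ^ z.
Proof.
pose k := A + 3 + c; exists (2 * k).
apply: leq_trans (_ : 3 * k ^ 2 <= _).
  by rewrite -mulnn mulnA mulnC leq_mul // /k; lia.
by rewrite expnM; apply: three_sq_le_pow4; rewrite /k; lia.
Qed.

Lemma hr_le_dr : (hr <= dr)%R. Proof. by rewrite /hr /dr; lra. Qed.

Lemma failure_bound (V : finType) q w n c x La : n = #|V| -> 0 < w -> 0 < n ->
  q = 16 * x * La ->
  7 * w * (q + 2) * n * n ^ c <= 2 ^ (x * La) ->
  ((6 * w)%N%:R * peps q V + #|V|%:R * dr ^+ q <= 1 / n%:R ^+ c)%R.
Proof.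
move=> nV w0 n0 Eq H.
have D : (dr ^+ q <= ((2 ^ (x * La))%N%:R)^-1)%R by rewrite Eq -mulnA dr_pow.
have P : (peps q V <= (q + 2)%N%:R * n%:R * dr ^+ q)%R.
  rewrite /peps -nV mulrA.
  have : (hr ^+ q * n%:R <= dr ^+ q * n%:R :> rat)%R.
    by rewrite ler_wpM2r // lerXn2r ?nnegrE ?hr_ge0 ?dr_ge0 ?hr_le_dr.
  move=> h; apply: le_trans (lerD (lexx _) h) _.
  rewrite [(dr ^+ q * _)%R]mulrC -mulrDl; apply: ler_wpM2r; first exact: dr_exp_ge0.
  by rewrite -natrM -natrD -natrM ler_nat; lia.
apply: le_trans (_ : (7 * w * (q + 2) * n)%N%:R * dr ^+ q <= _)%R.
  apply: le_trans (lerD (ler_wpM2l (ler0n _ _) P) (lexx _)) _.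
  rewrite -nV !mulrA -mulrDl; apply: ler_wpM2r; first exact: dr_exp_ge0.
  rewrite -!natrM -natrD ler_nat.
  have : n <= w * (q + 2) * n by rewrite leq_pmull // muln_gt0 w0; lia.
  lia.
apply: le_trans (ler_wpM2l (ler0n _ _) D) _.
rewrite div1r -natrX ler_pdivrMr ?ltr0n ?expn_gt0 // mulrC ler_pdivlMr ?ltr0n ?expn_gt0 ?n0 //.
by rewrite -natrM ler_nat.
Qed.

(** A polynomial overestimate of [n] costs only a constant factor in the logarithm. *)
Lemma up_log_poly a n N : 1 < n -> N <= a * n ^ a ->
  (up_log 2 N).+1 <= (2 * a + 1) * up_log 2 n.
Proof.
move=> n1 Na; have l0 : 0 < up_log 2 n by rewrite up_log_gt0.
set l := up_log 2 n in l0 *.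
have h : up_log 2 N <= a + l * a.
  apply: up_log_min => //; apply: leq_trans Na _; rewrite expnD expnM leq_mul //.
    exact/ltnW/ltn_expl.
  by case: a => // a; rewrite leq_exp2r // up_logP.
by move: h; clear Na; nia.
Qed.

(** Each of [n], [La] and [w] is at most a constant times y = 2^La, so the left side is at most 126
    * (alpha + 1) * x * y^(3 + c), and the factor before the power is at most 2^z <= y^z. *)
Lemma failure_count alpha c z La n w :
  126 * alpha.+1 * (z + 3 + c) <= 2 ^ z -> 0 < La -> 0 < n -> n <= 2 ^ La -> w <= alpha.+1 * n ->
  7 * w * (16 * (z + 3 + c) * La + 2) * n * n ^ c <= 2 ^ ((z + 3 + c) * La).
Proof.
set x := z + 3 + c => Hz La0 n0 nL wn; pose y := 2 ^ La.
have Ly : La <= y by apply/ltnW/ltn_expl.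
have y0 : 0 < y by rewrite expn_gt0.
have x0 : 0 < x by rewrite /x addn_gt0 addn_gt0 orbT.
have wy : w <= alpha.+1 * y by apply: leq_trans wn _; rewrite leq_mul2l nL orbT.
have qy : 16 * x * La + 2 <= 18 * x * y.
  have h1 : 16 * x * La <= 16 * x * y by rewrite leq_mul2l Ly orbT.
  have h2 : 0 < x * y by rewrite muln_gt0 x0.
  have -> : 18 * x * y = 16 * x * y + 2 * (x * y) by lia.
  by rewrite leq_add // leq_pmulr.
apply: leq_trans (_ : 7 * (alpha.+1 * y) * (18 * x * y) * y * y ^ c <= _).
  do !apply: leq_mul => //.
  by case: (c) => // k; rewrite leq_exp2r.
have -> : 7 * (alpha.+1 * y) * (18 * x * y) * y * y ^ c = 126 * alpha.+1 * x * y ^ (3 + c).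
  by rewrite expnD !expnS expn0; lia.
apply: leq_trans (leq_mul Hz (leqnn _)) _.
have zy : 2 ^ z <= y ^ z.
  case: (z) => // k; rewrite leq_exp2r // /y -{1}(expn1 2) leq_exp2l //.
apply: leq_trans (leq_mul zy (leqnn _)) _.
by rewrite -expnD addnA -/x /y -expnM mulnC.
Qed.

Lemma rounds_bound C alpha k x l D Dub : 0 < k -> Dub <= alpha * D -> x <= k * l ->
  C * (Dub + x ^ 6) <= C * (alpha + k ^ 6) * (D + l ^ 6).
Proof.
move=> k0 hD hx; rewrite -mulnA leq_mul2l; apply/orP; right.
have h : x ^ 6 <= k ^ 6 * l ^ 6 by rewrite -expnMn leq_exp2r.
rewrite mulnDl !mulnDr; lia.
Qed.

End Arithmetic.

Theorem theorem1 (a alpha beta mu c : nat) (hc : 1 <= c) :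
  exists (A : algorithm) (C : nat),
  forall (V : finType) (e : rel V) (s : V), connected_graph e ->
  forall (N Dub B : nat),
    #|V| <= N <= a * #|V| ^ a ->
    diameter e <= Dub <= alpha * diameter e ->
    up_log 2 #|V| <= beta * B ->
  forall (m : message), size m <= mu * B ->
  forall t : nat, C * (diameter e + up_log 2 #|V| ^ 6) <= t ->
    (1 - 1 / #|V|%:R ^+ c <= delivery_prob (A N Dub B) e s m t)%R.
Proof.
(* The number of repetitions also enters the failure bound as a factor, so [z] has to make an
   exponential in [z] exceed a linear function of [z]. *)
have [z Hz] := linear_le_pow2 (126 * alpha.+1) c.
pose x := z + 3 + c; pose kap := 16 * x.
have kap3 : 2 < kap.
  have x0 : 0 < x by rewrite /x addn_gt0 addn_gt0 orbT.
  by rewrite /kap (leq_trans (_ : 2 < 16 * 1)) // leq_mul2l.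
exists (fun N Dub B => broadcast mu kap N Dub B).
exists ((1 + 72 * kap ^ 2 + 8 * kap * mu.+3) * (alpha + (2 * a + 1) ^ 6)).
move=> V e s [e_sym _ conn] N Dub B /andP[VN Na] /andP[Dl Dh] hB m hm t ht.
have n0 : 0 < #|V| by apply/card_gt0P; exists s.
(* For a single node the required probability is 1 - 1 = 0. *)
have [n1|n1] := leqP #|V| 1.
  have -> : #|V| = 1 by apply/eqP; rewrite eqn_leq n1.
  rewrite expr1n divr1 subrr /delivery_prob /uniform_prob.
  by rewrite divr_ge0 ?ler0n.
(* Packets are nonempty once there are two nodes, so [mu.+1] packets have room for the message and
   its end mark. *)
have B0 : 0 < B.
  have : 0 < up_log 2 #|V| by rewrite up_log_gt0.
  by move=> /leq_trans/(_ hB); rewrite muln_gt0 => /andP[].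
have msz : size m < mu.+1 * B.
  by apply: leq_ltn_trans hm _; rewrite mulSn -[X in X < _]add0n ltn_add2r.
have szt : size (program mu kap N Dub B) <= t.
  apply: leq_trans (size_program _ _ _ _ _) _; first exact: leq_ltn_trans kap3.
  apply: leq_trans ht; apply: rounds_bound => //; first by rewrite addn1.
  exact: up_log_poly.
have D := delivery_prob_fail (p := program mu kap N Dub B) (node0 B Dub) (msg (B := B)) e s m szt.
apply: le_trans D; rewrite lerD2l lerN2.
apply: le_trans (program_fail s e_sym conn VN Dl msz kap3) _.
apply: (@failure_bound _ _ _ _ _ x (p_La N)) => //.
apply: (failure_count Hz) => //.
  apply: leq_trans VN _; apply: leq_trans (_ : 2 ^ up_log 2 N <= _).
    exact: up_logP.
  by rewrite leq_exp2l.
rewrite /p_w mulSn -addn1 addnC leq_add //.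
apply: leq_trans (leq_div _ _) _; apply: leq_trans Dh _.
by rewrite leq_mul2l diameter_card orbT.
Qed.
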